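(* Let $(\xi_k)_{k\in\mathbb{Z}}$ be an i.i.d. sequence of centered, square integrable real random variables. There exists a square summable sequence $(a_n)_{n\ge 0}$ such that, if $$X_k:=\sum_{j\ge 0}a_j\,\xi_{k-j}\quad (k\in\mathbb{Z}),\qquad S_n(\theta):=\sum_{k=0}^{n-1}e^{ik\theta}X_k,$$ then $$\mathbb{P}\left(\limsup_{n\to\infty}\frac{|E_0S_n(\theta)|}{\sqrt n}=\infty\right)=1$$ for all $\theta\in[0,2\pi)$.
   Context: The process $(X_k)_{k\in\mathbb{Z}}$ is the linear process generated by $(a_k)$ and $(\xi_k)$ (the series converges in $L^2$), and $S_n(\theta)$ is its $n$-th discrete Fourier transform at $\theta$. The sequence $(\xi_k)$ is identified with the coordinate functions on $\mathbb{R}^{\mathbb{Z}}$ with the product sigma-algebra, and $\mathbb{P}$ is the law of $(\xi_k)_{k\in\mathbb{Z}}$ on this space. $E_0Z:=E[Z\mid\mathcal{F}_0]$, where $\mathcal{F}_0=\sigma(\xi_k:k\le 0)$.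
   Formalization: The random variables are additionally assumed to have nonzero variance; if they vanish almost surely, then every S_n(θ) is zero and the claim fails for every sequence (a_n). *)

(* Defs.v *)
From HB Require Import structures.
From mathcomp Require Import all_boot all_order all_algebra.
From mathcomp Require Import all_classical all_reals all_analysis.
From mathcomp Require Import complex.

Set Implicit Arguments.
Unset Strict Implicit.
Unset Printing Implicit Defensive.
Import Order.TTheory GRing.Theory Num.Theory numFieldNormedType.Exports.

Local Open Scope classical_set_scope.
Local Open Scope ring_scope.
Local Open Scope complex_scope.

Definition mutually_independent (R : realType) (d : measure_display)
    (T : measurableType d) (P : probability T R) (I : choiceType)
    (xi : I -> {RV P >-> R}) : Prop :=
  forall (s : seq I) (B : I -> set R), uniq s ->
    (forall i, measurable (B i)) ->
    P (\bigcap_(i in [set` s]) (xi i @^-1` B i)) =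
    (\prod_(i <- s) P (xi i @^-1` B i))%E.

Definition identically_distributed (R : realType) (d : measure_display)
    (T : measurableType d) (P : probability T R) (I : choiceType)
    (xi : I -> {RV P >-> R}) : Prop :=
  forall (i j : I) (B : set R), measurable B ->
    distribution P (xi i) B = distribution P (xi j) B.

Definition iid (R : realType) (d : measure_display)
    (T : measurableType d) (P : probability T R) (I : choiceType)
    (xi : I -> {RV P >-> R}) : Prop :=
  mutually_independent xi /\ identically_distributed xi.

Definition square_summable (R : realType) (a : R^nat) : Prop :=
  cvgn (series (fun n => a n ^+ 2)).

(* X is determined by this only up to a modification: each X k is an arbitrary
   representative of the L^2 limit. *)
Definition is_linear_process (R : realType) (d : measure_display)
    (T : measurableType d) (P : probability T R) (a : R^nat)
    (xi X : int -> {RV P >-> R}) : Prop :=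
  forall k : int,
    (fun N : nat =>
       Lnorm P 2%:E
         (fun w => (X k w - \sum_(0 <= j < N) a j * xi (k - j%:Z) w)%:E))
      @ \oo --> 0%E.

Definition dft (R : realType) (T : Type) (X : int -> T -> R) (n : nat)
    (theta : R) (w : T) : R[i] :=
  \sum_(0 <= k < n)
    (cos (k%:R * theta) +i* sin (k%:R * theta)) * (X k%:Z w)%:C.

Definition past (R : realType) (d : measure_display) (T : measurableType d)
    (P : probability T R) (xi : int -> {RV P >-> R}) : set (set T) :=
  <<s \bigcup_(k in [set k : int | k <= 0]) g_sigma_algebra_preimage (xi k) >>.

(* Y is a version of E[Z | G]; G is meant to be a sub-sigma-algebra of the
   measurable sets of T. *)
Definition is_cond_exp (R : realType) (d : measure_display)
    (T : measurableType d) (P : probability T R) (G : set (set T))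
    (Z Y : T -> R) : Prop :=
  [/\ P.-integrable setT (EFin \o Z),
      P.-integrable setT (EFin \o Y),
      forall B : set R, measurable B -> G (Y @^-1` B) &
      forall A : set T, G A ->
        (\int[P]_(w in A) (Y w)%:E = \int[P]_(w in A) (Z w)%:E)%E].

(* Complex conditional expectations are taken componentwise. *)
Definition is_complex_cond_exp (R : realType) (d : measure_display)
    (T : measurableType d) (P : probability T R) (G : set (set T))
    (Z Y : T -> R[i]) : Prop :=
  is_cond_exp P G (fun w => complex.Re (Z w)) (fun w => complex.Re (Y w)) /\
  is_cond_exp P G (fun w => complex.Im (Z w)) (fun w => complex.Im (Y w)).

(* Main.v *)
Require Import Defs.
From HB Require Import structures.
From mathcomp Require Import all_boot all_order all_algebra.
From mathcomp Require Import all_classical all_reals all_analysis.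
From mathcomp Require Import complex.
From mathcomp Require Import measurable_realfun ring lra.

Import Order.TTheory GRing.Theory Num.Theory numFieldNormedType.Exports.
Local Open Scope classical_set_scope.
Local Open Scope ring_scope.

(** The coefficients are a sparse sequence of spikes: a spike of height beta_r
    stands at position N_r, where the N_r grow very fast and the heights
    decrease very fast.  The point is that E_0 S_n / sqrt n is then close to a
    Gaussian-like variable of small variance, but a new, independent one at
    every scale of n, and there are so many scales between N_(r-1) and N_r
    that one of them makes it large.

    Fix r and take times k with N_(r-1) < k <= N_r.  In
    E_0 X_k = sum_(j >= k) a_j xi_(k-j) the spikes before N_r are gone, since
    they multiply noise of positive time; the spike at N_r contributes
    beta_r xi_(k - N_r); the later spikes contribute an error whose mean size
    is at most E|xi| times the sum of their heights, which is chosen tiny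
    compared with 1 / N_r ([increment_dist]).  So along the times n_j = Q ^ 2 * 4 ^ j
    the increment of E_0 S_n over the window [n_j, n_(j+1)[ is, up to a
    negligible error, beta_r times the sum of e^(ik theta) xi_(k - N_r) over
    that window, and these sums are independent.

    Each of them exceeds any prescribed multiple of sqrt(n_(j+1)) / beta_r with
    a probability bounded below independently of j and theta.  This rests on an
    anticoncentration bound uniform over all linear forms Y = sum b_k xi_k
    ([anticoncentration]): Y >= c * sqrt(sum b_k ^ 2) with probability at
    least p > 0.  Its proof correlates Y with the imaginary part V of the Riesz
    product prod (1 + i b_k psi(xi_k)), where psi is bounded, centred and
    correlated with the noise and the b_k are normalized by sum b_k ^ 2 = 1:
    then V is bounded and E[Y V] is a positive constant, which needs only
    independence and two moments.  Cutting a window into q = 3 * Q ^ 2 blocks of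
    equal length and asking that all of them be favourable gains a factor
    sqrt q, at the price of replacing p by p ^ q ([cos_sin_window]); Q is chosen
    so that Q * beta_r is large.

    With enough windows some increment is large with probability close to 1
    ([probability_not_large]), and a large increment makes |E_0 S_n| large at
    one end of its window.  Letting r grow gives the limit superior. *)

(** * Independence of sigma-algebras generated by disjoint families *)

Section Independence.
Context {R : realType} {d : measure_display} {T : measurableType d}
  (P : probability T R) {I : choiceType} (xi : I -> {RV P >-> R}).
Implicit Types (K : set I) (A B : set T).

Definition sigma_of K : set (set T) :=
  <<s \bigcup_(k in K) g_sigma_algebra_preimage (xi k) >>.

Definition cylinders K : set (set T) :=
  [set A | exists (s : seq I) (B : I -> set R),
    [/\ uniq s, [set` s] `<=` K, forall i, measurable (B i) &
        A = \bigcap_(i in [set` s]) (xi i @^-1` B i)]].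

Lemma measurable_rv_preimage i (B : set R) : measurable B ->
  measurable (xi i @^-1` B).
Proof.
by move=> mB; rewrite -[X in measurable X]setTI; exact: measurable_funP.
Qed.

Lemma cylinders_measurable {K A} : cylinders K A -> measurable A.
Proof.
move=> [s [B [_ _ mB ->]]]; apply: fin_bigcap_measurable => // i _.
exact: measurable_rv_preimage.
Qed.

Lemma cylinders_setI_closed K : setI_closed (cylinders K).
Proof.
move=> _ _ [s1 [B1 [us1 sK1 mB1 ->]]] [s2 [B2 [us2 sK2 mB2 ->]]].
exists (undup (s1 ++ s2)), (fun i => (if i \in s1 then B1 i else setT) `&`
   (if i \in s2 then B2 i else setT)); split.
- exact: undup_uniq.
- move=> i /=; rewrite mem_undup mem_cat => /orP[is1|is2].
    exact: sK1.
  exact: sK2.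
- by move=> i; apply: measurableI; case: ifP.
- apply/seteqP; split => w /=.
    move=> [H1 H2] i /= _; split; case: ifP => // ?; [exact: H1|exact: H2].
  move=> H; split => i /= is_.
    by have := H i; rewrite /= mem_undup mem_cat is_ => /(_ isT)[].
  by have := H i; rewrite /= mem_undup mem_cat is_ orbT => /(_ isT)[].
Qed.

Lemma sigma_of_cylinders {K A} : sigma_of K A -> <<s cylinders K >> A.
Proof.
apply: smallest_sub; first exact: smallest_sigma_algebra.
move=> B [k Kk [C mC <-]]; apply: sub_sigma_algebra.
exists [:: k], (fun=> C); split=> //.
  by move=> i /=; rewrite inE => /eqP ->.
rewrite setTI; apply/seteqP; split => w /=.
  by move=> Cw i /=; rewrite inE => /eqP ->.
by apply; rewrite /= inE.
Qed.

Lemma sigma_of_measurable {K A} : sigma_of K A -> measurable A.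
Proof.
apply: smallest_sub; first exact: sigma_algebra_measurable.
move=> B [k Kk [C mC <-]]; rewrite setTI.
exact: measurable_rv_preimage.
Qed.

Local Notation generated_type K :=
  (g_sigma_algebraType (\bigcup_(k in K) g_sigma_algebra_preimage (xi k))).

Lemma sigma_ofT {K} : sigma_of K setT.
Proof. exact: (@measurableT _ (generated_type K)). Qed.

Lemma sigma_ofC {K A} : sigma_of K A -> sigma_of K (~` A).
Proof. exact: (@measurableC _ (generated_type K)). Qed.

Lemma sigma_ofI {K A B} : sigma_of K A -> sigma_of K B -> sigma_of K (A `&` B).
Proof. exact: (@measurableI _ (generated_type K)). Qed.

Lemma indep_dynkin B : measurable B ->
  dynkin [set A | measurable A /\ P (A `&` B) = (P A * P B)%E].
Proof.
move=> mB; split=> [|A [mA AB]|F tF mF] /=.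
- by rewrite setTI probability_setT mul1e.
- split; first exact: measurableC.
  have PE : P B = (P (A `&` B) + P (~` A `&` B))%E.
    rewrite -measureU; [|exact: measurableI|exact: measurableI (measurableC _) _|].
      by rewrite -setIUl setUv setTI.
    by rewrite setIACA setICr set0I.
  rewrite probability_setC//.
  have fP C : measurable C -> P C = (fine (P C))%:E.
    by move=> mC; rewrite fineK// fin_num_measure.
  move: PE AB; rewrite (fP _ mA) (fP _ mB) (fP _ (measurableI _ _ mA mB)).
  rewrite (fP _ (measurableI _ _ (measurableC mA) mB)).
  rewrite -EFinM -EFinD -EFinB -EFinM => -[E1] [E2].
  by congr EFin; lra.
- have mU : measurable (\bigcup_k F k) by apply: bigcup_measurable => k _; case: (mF k).
  have mFB k : measurable (F k `&` B) by apply: measurableI => //; case: (mF k).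
  split => //; rewrite setI_bigcupl.
  rewrite !measure_semi_bigcup//=; last 3 first.
  + by move=> i; case: (mF i).
  + exact: trivIset_setIr.
  + exact: bigcup_measurable.
  rewrite muleC -(fineK (fin_num_measure P B mB)) -nneseriesZl//.
  rewrite fineK ?fin_num_measure//.
  by apply: eq_eseriesr => k _; rewrite muleC; case: (mF k).
Qed.

(** Being independent of a fixed event is a Dynkin property, so it passes from
    a pi-system to the sigma-algebra that it generates. *)
Lemma indep_generated {C : set (set T)} {A B} :
  setI_closed C -> C `<=` measurable -> measurable B ->
  (forall A', C A' -> P (A' `&` B) = (P A' * P B)%E) ->
  <<s C >> A -> P (A `&` B) = (P A * P B)%E.
Proof.
move=> CI Cm mB CB.
suff /[apply] : <<s C >> `<=` [set A | measurable A /\ P (A `&` B) = (P A * P B)%E].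
  by case.
apply: lambda_system_subset => //.
  exact/dynkin_lambda_system/indep_dynkin.
by move=> A' CA' /=; split; [exact: Cm|exact: CB].
Qed.

Hypothesis xi_indep : mutually_independent xi.

Lemma cylinders_indep {K K' A B} : K `&` K' = set0 ->
  cylinders K A -> cylinders K' B -> P (A `&` B) = (P A * P B)%E.
Proof.
move=> KK' [s1 [B1 [us1 sK1 mB1 ->]]] [s2 [B2 [us2 sK2 mB2 ->]]].
have s12 i : i \in s1 -> i \in s2 -> False.
  by move=> /sK1 K1i /sK2 K2i; have : (K `&` K') i by []; rewrite KK'.
pose C i := if i \in s1 then B1 i else B2 i.
have mC i : measurable (C i) by rewrite /C; case: ifP.
have us : uniq (s1 ++ s2).
  rewrite cat_uniq us1 us2 /= andbT; apply/hasPn => i is2.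
  by apply/negP => is1; exact: (s12 i).
have BE : \bigcap_(i in [set` s1]) (xi i @^-1` B1 i) `&`
          \bigcap_(i in [set` s2]) (xi i @^-1` B2 i) =
          \bigcap_(i in [set` s1 ++ s2]) (xi i @^-1` C i).
  apply/seteqP; split => w /=.
    move=> [H1 H2] i /=; rewrite mem_cat /C.
    by case: ifPn => //= [is1 _|_]; [exact: H1|exact: H2].
  move=> H; split => i /= is_; have := H i; rewrite /= mem_cat is_ ?orbT /C.
    by rewrite is_; apply.
  by case: ifPn => [/s12/(_ is_)//|_]; apply.
rewrite BE !xi_indep// big_cat/=; congr (_ * _)%E.
  by apply: eq_big_seq => i is1; rewrite /C is1.
by apply: eq_big_seq => i is2; rewrite /C; case: ifPn => // /s12/(_ is2).
Qed.

(** Two applications of [indep_generated], one for each factor. *)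
Lemma sigma_of_indep {K K' A B} : K `&` K' = set0 ->
  sigma_of K A -> sigma_of K' B -> P (A `&` B) = (P A * P B)%E.
Proof.
move=> KK' KA K'B.
have mB := sigma_of_measurable K'B.
apply: (indep_generated (cylinders_setI_closed K) _ mB _ (sigma_of_cylinders KA)).
  by move=> ? /cylinders_measurable.
move=> A' CA'; have mA' := cylinders_measurable CA'.
rewrite setIC muleC.
apply: (indep_generated (cylinders_setI_closed K') _ mA' _ (sigma_of_cylinders K'B)).
  by move=> ? /cylinders_measurable.
by move=> B' CB'; rewrite setIC muleC; exact: (cylinders_indep KK').
Qed.

End Independence.

(** * Means of integrable functions *)

Lemma measurable_ge {R : realType} {d : measure_display} {T : measurableType d}
  (F : T -> R) (c : R) : measurable_fun setT F -> measurable [set w | c <= F w].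
Proof.
move=> mF; have := mF measurableT _ (measurable_itv `[c, +oo[).
by rewrite setTI; congr measurable; apply/seteqP; split => w /=;
  rewrite in_itv/= andbT.
Qed.

Section Mean.
Context {R : realType} {d : measure_display} {T : measurableType d}
  (P : probability T R).
Implicit Types (F G : T -> R) (m : R).

(** Integrability and the value of the integral are recorded together, with a
    real value, so that computations stay in the field of real numbers. *)
Definition mean_is F m :=
  P.-integrable setT (EFin \o F) /\ (\int[P]_w (F w)%:E = m%:E)%E.

Lemma mean_measurable {F m} : mean_is F m -> measurable_fun setT F.
Proof. by case=> /measurable_int /measurable_EFinP. Qed.

Lemma integrable_mean {F} : P.-integrable setT (EFin \o F) ->
  exists m, mean_is F m.
Proof.
move=> iF; exists (fine (\int[P]_w (F w)%:E)%E); split => //.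
by rewrite fineK//; exact: integrable_fin_num.
Qed.

Lemma mean_unique {F m m'} : mean_is F m -> mean_is F m' -> m = m'.
Proof. by move=> [_ H] [_]; rewrite H => -[]. Qed.

Lemma meanD {F G m m'} : mean_is F m -> mean_is G m' ->
  mean_is (fun w => F w + G w) (m + m').
Proof.
move=> [iF F_] [iG G_]; split.
  by rewrite (_ : _ \o _ = (EFin \o F) \+ (EFin \o G))%E//; exact: integrableD.
under eq_integral do rewrite EFinD.
by rewrite integralD// F_ G_.
Qed.

Lemma meanZ {F m} k : mean_is F m -> mean_is (fun w => k * F w) (k * m).
Proof.
move=> [iF F_]; split.
  rewrite (_ : _ \o _ = (fun w => k%:E * (EFin \o F) w))%E//.
  exact: integrableZl.
under eq_integral do rewrite EFinM.
by rewrite integralZl// F_.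
Qed.

Lemma mean_cst k : mean_is (fun=> k) k.
Proof.
split; last by rewrite integral_cst//= probability_setT mule1.
exact: finite_measure_integrable_cst.
Qed.

Lemma mean_indic {A : set T} : measurable A -> mean_is \1_A (fine (P A)).
Proof.
move=> mA; split; last first.
  by rewrite integral_indic// setIT fineK// fin_num_measure.
exact: integrable_indic.
Qed.

Lemma mean_abs {F m} : mean_is F m -> exists m', mean_is (fun w => `|F w|) m'.
Proof. by move=> [iF _]; apply: integrable_mean; exact: integrable_abse iF. Qed.

Lemma mean_le {F G m m'} : mean_is F m -> mean_is G m' ->
  (forall w, F w <= G w) -> m <= m'.
Proof.
move=> [iF F_] [iG G_] FG; rewrite -lee_fin -F_ -G_.
by apply: le_integral => // w _; rewrite lee_fin.
Qed.

Lemma mean_ext {F G m m'} :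
  mean_is F m -> F =1 G -> m = m' -> mean_is G m'.
Proof. by move=> Fm /funext <- <-. Qed.

Lemma mean_sum {J : Type} (s : seq J) (F : J -> T -> R) (m : J -> R) :
  (forall j, mean_is (F j) (m j)) ->
  mean_is (fun w => \sum_(j <- s) F j w) (\sum_(j <- s) m j).
Proof.
move=> mF; elim: s => [|j s IH].
  by apply: mean_ext (mean_cst 0) _ _ => [w|]; rewrite big_nil.
by apply: mean_ext (meanD (mF j) IH) _ _ => [w|]; rewrite big_cons.
Qed.

Lemma bounded_mean {F} k : measurable_fun setT F -> (forall w, `|F w| <= k) ->
  exists m, mean_is F m.
Proof.
move=> mF Fk; apply: integrable_mean.
have [ik _] := mean_cst k.
apply: (le_integrable _ _ _ ik) => //; first exact/measurable_EFinP.
move=> w _ /=; rewrite lee_fin (le_trans (Fk w))// ler_norm//.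
Qed.

Lemma dominated_mean {F G m} : measurable_fun setT F -> mean_is G m ->
  (forall w, `|F w| <= G w) -> exists m, mean_is F m.
Proof.
move=> mF [iG _] FG; apply: integrable_mean.
apply: (le_integrable _ _ _ iG) => //; first exact/measurable_EFinP.
by move=> w _ /=; rewrite lee_fin (le_trans (FG w))// ler_norm.
Qed.

Lemma markov_mean {F m} (k : R) : 0 < k -> mean_is (fun w => `|F w|) m ->
  (P [set w | (k <= `|F w|)%R] <= (m / k)%:E)%E.
Proof.
move=> k0 mF.
have mA : measurable [set w | k <= `|F w|].
  by apply: measurable_ge; exact: mean_measurable mF.
have := mean_le (meanZ k (mean_indic mA)) mF.
rewrite -[X in (X <= _)%E]fineK ?fin_num_measure// lee_fin ler_pdivlMr// mulrC.
apply => w; rewrite indicE; case: (boolP (w \in _)) => [|_]; last by rewrite mulr0.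
by rewrite inE/= mulr1.
Qed.

(** The hypothesis says that the joint law of F and G is the product of their
    laws; Fubini's theorem does the rest, including the integrability of the
    product. *)
Lemma mean_mul_indep {F G m m'} :
  (forall A B, measurable A -> measurable B ->
     P (F @^-1` A `&` G @^-1` B) = (P (F @^-1` A) * P (G @^-1` B))%E) ->
  mean_is F m -> mean_is G m' -> mean_is (fun w => F w * G w) (m * m').
Proof.
move=> FG mF mG.
have mF_ := mean_measurable mF; have mG_ := mean_measurable mG.
pose F' : {RV P >-> R} := HB.pack F (isMeasurableFun.Build _ _ _ _ F mF_).
pose G' : {RV P >-> R} := HB.pack G (isMeasurableFun.Build _ _ _ _ G mG_).
pose mu : probability R R := distribution P F'.
pose nu : probability R R := distribution P G'.
have mFG : measurable_fun setT (fun w => (F w, G w)).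
  exact: measurable_fun_pair.
pose FG' : {RV P >-> (R * R)%type} := HB.pack (fun w => (F w, G w))
   (isMeasurableFun.Build _ _ _ _ (fun w => (F w, G w)) mFG).
have joint X : measurable X -> (mu \x nu)%E X = distribution P FG' X.
  by move=> mX; apply: product_measure_unique.
pose f (z : R * R) := (z.1 * z.2)%:E.
have mf : measurable_fun setT f.
  apply/measurable_EFinP; apply: measurable_funM.
    exact: measurable_fst.
  exact: measurable_snd.
have int_norm H h (H' : {RV P >-> R}) : H = H' :> (T -> R) -> mean_is H h ->
    (\int[distribution P H']_x `|x%:E| < +oo)%E.
  move=> HH' [/integrableP[_ iH] _].
  rewrite ge0_integral_distribution//; last exact: measurableT_comp.
  by rewrite -HH'.
have int_val H h (H' : {RV P >-> R}) : H = H' :> (T -> R) -> mean_is H h ->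
    (\int[distribution P H']_x x%:E = h%:E)%E.
  move=> HH' [iH Hh]; rewrite integral_distribution//; first by rewrite -Hh HH'.
  by rewrite -HH'.
have intf : (mu \x nu)%E.-integrable setT f.
  apply/integrable12ltyP => //.
  under eq_integral.
    move=> x _.
    under eq_integral do rewrite /f/= normrM EFinM.
    rewrite ge0_integralZl//; last exact: measurableT_comp.
    over.
  have /= nuoo := int_norm G m' G' erefl mG.
  have /= muoo := int_norm F m F' erefl mF.
  rewrite /= ge0_integralZr//; last 2 first.
  - exact: measurableT_comp.
  - exact: integral_ge0.
  rewrite lte_mul_pinfty//.
  - exact: integral_ge0.
  - by rewrite ge0_fin_numE//; exact: integral_ge0.
have intFG : P.-integrable setT (f \o FG').
  apply/integrableP; split; first exact: measurableT_comp.
  have /integrableP[_] := intf.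
  rewrite (eq_measure_integral (distribution P FG')); last first.
    by move=> *; exact: joint.
  rewrite ge0_integral_distribution//.
  exact: measurableT_comp.
split => //.
have -> : (\int[P]_w (F w * G w)%:E = \int[P]_w (f \o FG') w)%E by [].
rewrite -integral_distribution//.
rewrite (eq_measure_integral (mu \x nu)%E); last by move=> *; exact: (esym (joint _ _)).
rewrite -integral12_prod_meas1// /fubini_F/=.
under eq_integral.
  move=> x _.
  under eq_integral do rewrite /f/= EFinM.
  rewrite integralZl//; last first.
    apply/integrableP; split; first exact: measurableT_comp.
    exact: (int_norm G m' G' erefl mG).
  rewrite (int_val G m' G' erefl mG).
  over.
rewrite integralZr//; last first.
  apply/integrableP; split; first exact: measurableT_comp.
  exact: (int_norm F m F' erefl mF).
by rewrite (int_val F m F' erefl mF).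
Qed.

End Mean.

Arguments mean_ext {R d T P F G m m'}.

(** * Functions that depend on part of the noise only *)

Section Adapted.
Context {R : realType} {d : measure_display} {T : measurableType d}
  {P : probability T R} {I : choiceType} (xi : I -> {RV P >-> R}).
Implicit Types (K : set I) (F G : T -> R).

Definition adapted K F := forall B, measurable B -> sigma_of P xi K (F @^-1` B).

Local Notation generated_type K :=
  (g_sigma_algebraType (\bigcup_(k in K) g_sigma_algebra_preimage (xi k))).

Lemma adaptedP K F : adapted K F <-> measurable_fun (setT : set (generated_type K)) F.
Proof.
split=> [aF _ B mB|mF B mB]; first by rewrite setTI; exact: aF.
by have := mF measurableT _ mB; rewrite setTI.
Qed.

Lemma adapted_ext {K F G} : adapted K F -> F =1 G -> adapted K G.
Proof. by move=> aF /funext <-. Qed.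

Lemma adapted_cst K k : adapted K (fun=> k).
Proof. exact/adaptedP/measurable_cst. Qed.

Lemma adaptedD {K F G} : adapted K F -> adapted K G -> adapted K (fun w => F w + G w).
Proof. by move=> /adaptedP mF /adaptedP mG; apply/adaptedP/measurable_funD. Qed.

Lemma adaptedB {K F G} : adapted K F -> adapted K G -> adapted K (fun w => F w - G w).
Proof. by move=> /adaptedP mF /adaptedP mG; apply/adaptedP/measurable_funB. Qed.

Lemma adaptedM {K F G} : adapted K F -> adapted K G -> adapted K (fun w => F w * G w).
Proof. by move=> /adaptedP mF /adaptedP mG; apply/adaptedP/measurable_funM. Qed.

Lemma adaptedZ {K F} k : adapted K F -> adapted K (fun w => k * F w).
Proof. exact: adaptedM (adapted_cst K k). Qed.

Lemma adapted_comp {K F} (g : R -> R) : measurable_fun setT g -> adapted K F ->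
  adapted K (g \o F).
Proof. by move=> mg /adaptedP mF; apply/adaptedP; exact: measurableT_comp. Qed.

Lemma adapted_rv K k : K k -> adapted K (xi k).
Proof.
move=> Kk B mB; apply: sub_sigma_algebra; exists k => //; exists B => //.
by rewrite setTI.
Qed.

Lemma sigma_of_mono {K K'} : K `<=` K' -> sigma_of P xi K `<=` sigma_of P xi K'.
Proof.
move=> KK'; apply: smallest_sub; first exact: smallest_sigma_algebra.
move=> A [k Kk Ak]; apply: sub_sigma_algebra; exists k => //; exact: KK'.
Qed.

Lemma adapted_mono {K K' F} : K `<=` K' -> adapted K F -> adapted K' F.
Proof. by move=> KK' aF B mB; exact: (sigma_of_mono KK') (aF B mB). Qed.

Lemma adapted_sum {K} {J : eqType} (s : seq J) (F : J -> T -> R) :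
  (forall j, j \in s -> adapted K (F j)) ->
  adapted K (fun w => \sum_(j <- s) F j w).
Proof.
elim: s => [|j s IH] aF.
  by under eq_fun do rewrite big_nil; exact: adapted_cst.
under eq_fun do rewrite big_cons.
apply: adaptedD; first by apply: aF; rewrite mem_head.
by apply: IH => i si; apply: aF; rewrite inE si orbT.
Qed.

Lemma adapted_ge {K F} (c : R) : adapted K F -> sigma_of P xi K [set w | c <= F w].
Proof.
move=> aF; have := aF _ (measurable_itv `[c, +oo[).
by congr (sigma_of _ _ _ _); apply/seteqP; split => w /=; rewrite in_itv/= andbT.
Qed.

Hypothesis xi_indep : mutually_independent xi.

Lemma mean_mul_adapted {K K' F G m m'} : K `&` K' = set0 ->
  adapted K F -> adapted K' G -> mean_is P F m -> mean_is P G m' ->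
  mean_is P (fun w => F w * G w) (m * m').
Proof.
move=> KK' aF aG; apply: mean_mul_indep => A B mA mB.
exact: sigma_of_indep KK' (aF _ mA) (aG _ mB).
Qed.

End Adapted.

(** * Riesz products and anticoncentration of linear forms *)

Section RieszProduct.
Context {R : realType} {d : measure_display} {T : measurableType d}
  {P : probability T R} {I : choiceType} (xi : I -> {RV P >-> R}).
Hypothesis xi_indep : mutually_independent xi.
Variables (psi : R -> R) (tau v : R).
Hypotheses (mpsi : measurable_fun setT psi) (psi1 : forall x, `|psi x| <= 1)
  (xi_mean : forall i, mean_is P (xi i) 0)
  (xi_var : forall i, mean_is P (fun w => xi i w ^+ 2) v)
  (psi_mean : forall i, mean_is P (psi \o xi i) 0)
  (corr : forall i, mean_is P (fun w => xi i w * psi (xi i w)) tau).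

Definition linear_form (b : I -> R) (s : seq I) (w : T) := \sum_(i <- s) b i * xi i w.

(** The real and imaginary parts of the product of the 1 + i * b_k * psi(xi_k)
    over the indices k in s. *)
Fixpoint riesz (b : I -> R) (s : seq I) (w : T) : R * R :=
  if s is i :: s' then
    let: (U, V) := riesz b s' w in
    (U - b i * psi (xi i w) * V, V + b i * psi (xi i w) * U)
  else (1, 0).

Lemma riesz_cons b i s w : riesz b (i :: s) w =
  ((riesz b s w).1 - b i * psi (xi i w) * (riesz b s w).2,
   (riesz b s w).2 + b i * psi (xi i w) * (riesz b s w).1).
Proof. by rewrite /=; case: (riesz b s w). Qed.

(** The squared modulus is the product of the 1 + b_k ^ 2 * psi(xi_k) ^ 2. *)
Lemma riesz_le b s w :
  (riesz b s w).1 ^+ 2 + (riesz b s w).2 ^+ 2 <= expR (\sum_(i <- s) b i ^+ 2).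
Proof.
elim: s => [|i s IH]; first by rewrite big_nil expR0 /= expr0n addr0 expr1n.
rewrite riesz_cons big_cons expRD /=.
set U := (riesz b s w).1 in IH *; set V := (riesz b s w).2 in IH *.
set x := psi (xi i w).
have -> : (U - b i * x * V) ^+ 2 + (V + b i * x * U) ^+ 2 =
   (1 + b i ^+ 2 * x ^+ 2) * (U ^+ 2 + V ^+ 2) by ring.
apply: ler_pM => //.
- by rewrite addr_ge0// mulr_ge0// sqr_ge0.
- by rewrite addr_ge0// sqr_ge0.
- apply: le_trans (expR_ge1Dx _); rewrite lerD2l ler_piMr// ?sqr_ge0//.
  by rewrite -(real_normK (num_real x)) expr_le1//; exact: psi1.
Qed.

Lemma adapted_linear_form b s : adapted xi [set` s] (linear_form b s).
Proof. by apply: adapted_sum => i si; apply: adaptedZ; exact: adapted_rv. Qed.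

Lemma adapted_riesz b s :
  adapted xi [set` s] (fun w => (riesz b s w).1) /\
  adapted xi [set` s] (fun w => (riesz b s w).2).
Proof.
elim: s => [|i s [aU aV]]; first by split; exact: adapted_cst.
have sub : [set` s] `<=` [set` i :: s] by move=> j /= sj; rewrite inE sj orbT.
have ap : adapted xi [set` i :: s] (fun w => b i * psi (xi i w)).
  apply: adaptedZ; apply: (adapted_comp xi psi) => //.
  by apply: adapted_rv; rewrite /= mem_head.
have [aU' aV'] := (adapted_mono xi sub aU, adapted_mono xi sub aV).
split.
  apply: adapted_ext (adaptedB xi aU' (adaptedM xi ap aV')) _ => w.
  by rewrite [in RHS]riesz_cons.
apply: adapted_ext (adaptedD xi aV' (adaptedM xi ap aU')) _ => w.
by rewrite [in RHS]riesz_cons.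
Qed.

Lemma linear_form_cons b i s w :
  linear_form b (i :: s) w = b i * xi i w + linear_form b s w.
Proof. exact: big_cons. Qed.

Lemma linear_form_moments b s : uniq s ->
  mean_is P (linear_form b s) 0 /\
  mean_is P (fun w => linear_form b s w ^+ 2) (v * \sum_(i <- s) b i ^+ 2).
Proof.
elim: s => [_|i s IH /= /andP[is_ us]].
  rewrite big_nil mulr0; split.
    by apply: mean_ext (mean_cst P 0) _ _ => // w; rewrite /linear_form big_nil.
  by apply: mean_ext (mean_cst P 0) _ _ => // w; rewrite /linear_form big_nil expr0n.
have [mY mY2] := IH us.
have dis : [set i] `&` [set` s] = set0.
  by apply/seteqP; split=> // j [/= ->]; apply/negP.
have axi : adapted xi [set i] (xi i) by exact: adapted_rv.
split.
  apply: mean_ext (meanD P (meanZ P (b i) (xi_mean i)) mY) _ _.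
    by move=> w; rewrite linear_form_cons.
  by ring.
have mxY := mean_mul_adapted xi xi_indep dis axi (adapted_linear_form b s) (xi_mean i) mY.
apply: mean_ext (meanD P (meanD P (meanZ P (b i ^+ 2) (xi_var i))
   (meanZ P (2 * b i) mxY)) mY2) _ _.
  by move=> w; rewrite linear_form_cons; ring.
by rewrite big_cons; ring.
Qed.

(** In the expectation of c_k * xi_k times the product, every factor but the one
    of index k averages to 1, and that one leaves i * c_k * b_k * tau. *)
Lemma riesz_moments b c s : uniq s ->
  [/\ mean_is P (fun w => (riesz b s w).1) 1,
      mean_is P (fun w => (riesz b s w).2) 0,
      exists m, mean_is P (fun w => linear_form c s w * (riesz b s w).1) m &
      mean_is P (fun w => linear_form c s w * (riesz b s w).2)
        (tau * \sum_(i <- s) c i * b i)].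
Proof.
elim: s => [_|i s IH /= /andP[is_ us]].
  split; [exact: mean_cst|exact: mean_cst|exists 0|].
    by apply: mean_ext (mean_cst P 0) _ _ => // w; rewrite /linear_form big_nil mul0r.
  apply: mean_ext (mean_cst P 0) _ _; last by rewrite big_nil mulr0.
  by move=> w; rewrite /= mulr0.
have [mU mV [u mYU] mYV] := IH us.
have dis : [set i] `&` [set` s] = set0.
  by apply/seteqP; split=> // j [/= ->]; apply/negP.
have axi : adapted xi [set i] (xi i) by exact: adapted_rv.
have apsi : adapted xi [set i] (psi \o xi i) by exact: adapted_comp.
have axpsi := adaptedM xi axi apsi.
have [aU aV] := adapted_riesz b s.
have aY := adapted_linear_form c s.
have mm := mean_mul_adapted xi xi_indep dis.
have mpU := mm _ _ _ _ apsi aU (psi_mean i) mU.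
have mpV := mm _ _ _ _ apsi aV (psi_mean i) mV.
have mpYU := mm _ _ _ _ apsi (adaptedM xi aY aU) (psi_mean i) mYU.
have mpYV := mm _ _ _ _ apsi (adaptedM xi aY aV) (psi_mean i) mYV.
have mxU := mm _ _ _ _ axi aU (xi_mean i) mU.
have mxV := mm _ _ _ _ axi aV (xi_mean i) mV.
have mxpU := mm _ _ _ _ axpsi aU (corr i) mU.
have mxpV := mm _ _ _ _ axpsi aV (corr i) mV.
split.
- apply: mean_ext (meanD P mU (meanZ P (- b i) mpV)) _ _ => [w|]; last by ring.
  by rewrite -/(riesz _ (_ :: _) _) riesz_cons /=; ring.
- apply: mean_ext (meanD P mV (meanZ P (b i) mpU)) _ _ => [w|]; last by ring.
  by rewrite -/(riesz _ (_ :: _) _) riesz_cons /=; ring.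
- eexists.
  apply: mean_ext (meanD P (meanD P mYU (meanZ P (- b i) mpYV))
    (meanD P (meanZ P (c i) mxU) (meanZ P (- (c i * b i)) mxpV))) _ erefl => w.
  by rewrite -/(riesz _ (_ :: _) _) riesz_cons linear_form_cons /=; ring.
- apply: mean_ext (meanD P (meanD P mYV (meanZ P (b i) mpYU))
    (meanD P (meanZ P (c i) mxV) (meanZ P (c i * b i) mxpU))) _ _ => [w|].
    by rewrite -/(riesz _ (_ :: _) _) riesz_cons linear_form_cons /=; ring.
  by rewrite big_cons; ring.
Qed.

Lemma riesz_im_le2 b s w : \sum_(i <- s) b i ^+ 2 <= 1 -> `|(riesz b s w).2| <= 2.
Proof.
move=> b1.
have e2 : expR (1 : R) <= 2 ^+ 2.
  have h : expR (2^-1 : R) <= 2.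
    rewrite -[leLHS]invrK -expRN invf_ple ?posrE ?expR_gt0//.
    by have := expR_ge1Dx (- (2^-1 : R)); lra.
  have -> : expR (1 : R) = expR (2^-1) * expR (2^-1).
    by rewrite -expRD; congr expR; lra.
  by rewrite expr2 ler_pM ?expR_ge0.
rewrite -[2]ger0_norm// -ler_sqr ?nnegrE// !real_normK ?num_real//.
apply: le_trans e2; apply: (le_trans _ (le_trans (riesz_le b s w) _)).
  by rewrite lerDr sqr_ge0.
by rewrite ler_expR.
Qed.

Definition anticonc_prob := Num.min (tau ^+ 2 / (32 * v)) 1.

(** Let Y be the form, r the square root of the sum of the b_i ^ 2, and V the
    imaginary part of the Riesz product with the coefficients b_i / r, so that
    |V| <= 2 and E[Y V] = tau * r.  As Y is centred, E[Y (V + 2)] = tau * r as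
    well, and here the weight V + 2 is nonnegative and at most 4: a large mean
    forces Y itself, and not only |Y|, to be large on an event A.  The second
    moment v * r ^ 2 bounds what Y can contribute on A in terms of P(A). *)
Lemma anticoncentration b s : 0 < tau -> 0 < v -> uniq s ->
  (anticonc_prob%:E <=
   P [set w | (tau / 16 * Num.sqrt (\sum_(i <- s) b i ^+ 2) <= linear_form b s w)%R])%E.
Proof.
move=> tau0 v0 us; set e := \sum_(i <- s) _.
have e0 : 0 <= e by apply: sumr_ge0 => i _; exact: sqr_ge0.
set A := [set w | _]; set r := Num.sqrt e in A *.
have mA : measurable A.
  exact: sigma_of_measurable (adapted_ge xi _ (adapted_linear_form b s)).
have [r0|r_gt0] := leP r 0.
  have {}r0 : r = 0 by apply/eqP; rewrite eq_le r0 sqrtr_ge0.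
  have b0 i : i \in s -> b i = 0.
    move=> si; apply/eqP; rewrite -sqrf_eq0 eq_le sqr_ge0 andbT.
    move/eqP: r0; rewrite sqrtr_eq0; apply: le_trans.
    rewrite /e (big_rem i)//= lerDl; apply: sumr_ge0 => j _; exact: sqr_ge0.
  have -> : A = setT.
    apply/seteqP; split=> // w _; rewrite /A/= r0 mulr0.
    by rewrite /linear_form big1_seq// => i /andP[_ /b0 ->]; rewrite mul0r.
  by rewrite probability_setT lee_fin ge_min lexx orbT.
have r2 : r ^+ 2 = e by rewrite sqr_sqrtr.
(* Normalizing the coefficients keeps the Riesz product bounded. *)
pose b' i := r^-1 * b i.
have b'1 : \sum_(i <- s) b' i ^+ 2 <= 1.
  rewrite /b'; under eq_bigr do rewrite exprMn.
  by rewrite -mulr_sumr -/e -r2 -exprMn mulVf ?expr1n// gt_eqF.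
have bb' : \sum_(i <- s) b i * b' i = r.
  rewrite /b'; under eq_bigr do rewrite mulrCA -expr2.
  by rewrite -mulr_sumr -/e -r2 expr2 mulKf// gt_eqF.
have [mY mY2] := linear_form_moments b s us.
have [_ _ _ mYV] := riesz_moments b' b s us.
rewrite bb' in mYV.
(* The weight in Young's inequality 2 |Y| <= lam * r + Y ^ 2 / (lam * r), for
   which the second moment costs a quarter of tau * r. *)
pose lam := 8 * v / tau.
have lam0 : 0 < lam by rewrite divr_gt0// mulr_gt0.
have := mean_le P (meanD P mYV (meanZ P 2 mY))
  (meanD P (mean_cst P (4 * (tau / 16 * r)))
    (meanD P (meanZ P (2 * lam * r) (mean_indic P mA))
      (meanZ P (2 / (lam * r)) mY2))).
rewrite mulr0 addr0 -/e -r2.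
have -> : 2 / (lam * r) * (v * r ^+ 2) = tau / 4 * r.
  by rewrite /lam; field; rewrite !gt_eqF.
move=> H.
have {}H : tau ^+ 2 / (32 * v) <= fine (P A).
  rewrite ler_pdivrMr ?mulr_gt0//.
  have : tau * r <= (4 * (tau / 16) + (2 * lam * fine (P A) + tau / 4)) * r.
    apply: (le_trans (H _)); last by lra.
    move=> w; have /ler_normlP[V1 V2] := riesz_im_le2 b' s w b'1.
    set V := (riesz b' s w).2 in V1 V2 *; set Y := linear_form b s w.
    have k0 : 0 < lam * r by rewrite mulr_gt0.
    have q0 : 0 < tau / 16 * r by rewrite mulr_gt0// divr_gt0.
    have YV4 : Y * V + 2 * Y <= 4 * `|Y|.
      have -> : Y * V + 2 * Y = Y * (V + 2) by ring.
      apply: le_trans (ler_norm _) _; rewrite normrM mulrC ler_wpM2r//.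
      by rewrite ger0_norm; lra.
    rewrite indicE; case: (boolP (w \in A)) => [_|].
      apply: (le_trans YV4); rewrite mulr1 -subr_ge0.
      have -> : 4 * (tau / 16 * r) + (2 * lam * r + 2 / (lam * r) * Y ^+ 2) - 4 * `|Y| =
          4 * (tau / 16 * r) + 2 * (lam * r - `|Y|) ^+ 2 / (lam * r).
        rewrite -[Y ^+ 2]real_normK ?num_real//; field.
        by rewrite !gt_eqF.
      apply: addr_ge0; first by rewrite mulr_ge0// ltW.
      by rewrite divr_ge0 ?(ltW k0)// mulr_ge0// sqr_ge0.
    rewrite notin_setE /A/= => /negP; rewrite -ltNge -/Y => Yq.
    have Y2 : 0 <= 2 / (lam * r) * Y ^+ 2 by rewrite mulr_ge0 ?sqr_ge0// divr_ge0// ltW.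
    rewrite mulr0 add0r; have [Y0|Y0] := leP Y 0.
      have -> : Y * V + 2 * Y = Y * (V + 2) by ring.
      have : Y * (V + 2) <= 0 by rewrite mulr_le0_ge0//; lra.
      by lra.
    by move: YV4; rewrite gtr0_norm//; lra.
  rewrite ler_pM2r// => {}H.
  have {H}: tau * tau <= (4 * (tau / 16) + (2 * lam * fine (P A) + tau / 4)) * tau.
    by rewrite ler_pM2r.
  have -> : (4 * (tau / 16) + (2 * lam * fine (P A) + tau / 4)) * tau =
    tau ^+ 2 / 2 + 16 * (fine (P A) * v) by rewrite /lam; field; rewrite gt_eqF.
  by lra.
by rewrite -[P A]fineK ?fin_num_measure// lee_fin ge_min H.
Qed.

End RieszProduct.

(** * Independent blocks and windows *)

Section Blocks.
Context {R : realType} {d : measure_display} {T : measurableType d}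
  {P : probability T R} (z : nat -> {RV P >-> R}).
Hypothesis z_indep : mutually_independent z.

Definition interval a b : set nat := [set k | (a <= k < b)%N].

Variables (cut : nat -> nat) (E : nat -> set T).
Hypotheses (cut_le : forall j, (cut j <= cut j.+1)%N)
  (E_in : forall j, sigma_of P z (interval (cut j) (cut j.+1)) (E j)).

Lemma sigma_of_bigI q :
  sigma_of P z (interval (cut 0) (cut q)) (\big[setI/setT]_(j < q) E j).
Proof.
elim: q => [|q IH]; first by rewrite big_ord0; exact: sigma_ofT.
have c0 : (cut 0 <= cut q)%N.
  by elim: (q) => // k /leq_trans; apply.
rewrite big_ord_recr/=; apply: sigma_ofI.
  apply: sigma_of_mono IH => k /= /andP[k0 kq].
  by rewrite /interval/= k0; exact: leq_trans kq (cut_le q).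
apply: sigma_of_mono (E_in q) => k /= /andP[qk kq].
by rewrite /interval/= kq andbT; exact: leq_trans c0 qk.
Qed.

Lemma probability_bigI q :
  P (\big[setI/setT]_(j < q) E j) = (\prod_(j < q) P (E j))%E.
Proof.
elim: q => [|q IH]; first by rewrite !big_ord0 probability_setT.
rewrite !big_ord_recr/= -IH.
apply: (sigma_of_indep P z z_indep _ (sigma_of_bigI q) (E_in q)).
apply/seteqP; split=> // k [/= /andP[_ h1] /andP[h2 _]].
by have := leq_trans h1 h2; rewrite ltnn.
Qed.

Lemma probability_bigI_ge q (p : R) : 0 <= p -> (forall j, p%:E <= P (E j))%E ->
  ((p ^+ q)%:E <= P (\big[setI/setT]_(j < q) E j))%E.
Proof.
move=> p0 pE; rewrite probability_bigI.
elim: q => [|q IH]; first by rewrite big_ord0 expr0.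
rewrite big_ord_recr/= exprSr EFinM; apply: lee_pmul => //; rewrite lee_fin.
exact: exprn_ge0.
Qed.

Lemma probability_bigI_le q (p : R) : 0 <= p -> (forall j, P (E j) <= p%:E)%E ->
  (P (\big[setI/setT]_(j < q) E j) <= (p ^+ q)%:E)%E.
Proof.
move=> p0 pE; rewrite probability_bigI.
elim: q => [|q IH]; first by rewrite big_ord0 expr0.
rewrite big_ord_recr/= exprSr EFinM; apply: lee_pmul => //.
exact: prode_ge0.
Qed.

End Blocks.

(** The ends of the windows.  They are squares, so that no square root appears
    in the normalization by sqrt n (lemma [sqrt_scale]). *)
Definition scale Q j := (Q ^ 2 * 4 ^ j)%N.

Lemma scaleS Q j : scale Q j.+1 = (scale Q j + 3 * Q ^ 2 * 4 ^ j)%N.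
Proof. by rewrite /scale (expnS 4); ring. Qed.

Lemma scale_mono {Q i j} : (i <= j)%N -> (scale Q i <= scale Q j)%N.
Proof. by move=> ij; rewrite leq_mul2l leq_pexp2l// orbT. Qed.

Lemma sqrt_scale {R : realType} Q j :
  Num.sqrt (scale Q j)%:R = (Q * 2 ^ j)%:R :> R.
Proof.
have -> : (scale Q j = (Q * 2 ^ j) ^ 2)%N.
  by rewrite expnMn -[in RHS]expnM [(j * 2)%N]mulnC expnM.
by rewrite natrX sqrtr_sqr ger0_norm.
Qed.

Section Windows.
Context {R : realType} {d : measure_display} {T : measurableType d}
  {P : probability T R} (z : nat -> {RV P >-> R}).
Hypothesis z_indep : mutually_independent z.
Variables (psi : R -> R) (tau v : R).
Hypotheses (mpsi : measurable_fun setT psi) (psi1 : forall x, `|psi x| <= 1)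
  (z_mean : forall i, mean_is P (z i) 0)
  (z_var : forall i, mean_is P (fun w => z i w ^+ 2) v)
  (psi_mean : forall i, mean_is P (psi \o z i) 0)
  (corr : forall i, mean_is P (fun w => z i w * psi (z i w)) tau)
  (tau0 : 0 < tau) (v0 : 0 < v).
Let p := anticonc_prob tau v.

Lemma anticonc_prob_gt0 : 0 < p.
Proof. by rewrite lt_min ltr01 andbT divr_gt0 ?exprn_gt0// mulr_gt0. Qed.

Lemma sum_blocks (F : nat -> R) a l q :
  \sum_(a <= k < a + q * l) F k =
  \sum_(i < q) \sum_(a + i * l <= k < a + i.+1 * l) F k.
Proof.
elim: q => [|q IH]; first by rewrite mul0n addn0 big_ord0 big_geq.
rewrite big_ord_recr/= -IH (@big_cat_nat _ _ _ (a + q * l)%N)//= ?leq_addr//.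
by rewrite leq_add2l leq_mul2r leqnSn orbT.
Qed.

(** The window is the union of q blocks of length l.  If e is the energy of a
    block then e <= l <= h ^ 2, hence sqrt e >= e / h; so when every block meets
    its one-sided anticoncentration bound, these bounds add up to a multiple of
    the energy of the whole window, with no loss from its uneven distribution
    among the blocks. *)
Lemma linear_form_window b a l q (h : R) : 0 < h -> l%:R <= h ^+ 2 ->
  (forall k, b k ^+ 2 <= 1) ->
  (q * l)%:R / 2 <= \sum_(a <= k < a + q * l) b k ^+ 2 ->
  ((p ^+ q)%:E <= P [set w | (tau / 32 * ((q * l)%:R / h) <=
      linear_form z b (index_iota a (a + q * l)) w)%R])%E.
Proof.
move=> h0 lh b1 eb.
pose cut i := (a + i * l)%N.
pose s i := index_iota (cut i) (cut i.+1).
pose E i := [set w | (tau / 16 * Num.sqrt (\sum_(k <- s i) b k ^+ 2) <=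
  linear_form z b (s i) w)%R].
have sI i : [set` s i] = interval (cut i) (cut i.+1).
  by apply/seteqP; split => k /=; rewrite mem_index_iota.
have E_in i : sigma_of P z (interval (cut i) (cut i.+1)) (E i).
  by rewrite -sI; apply: adapted_ge; exact: adapted_linear_form.
have cut_le j : (cut j <= cut j.+1)%N by rewrite leq_add2l leq_mul2r leqnSn orbT.
have pE i : (p%:E <= P (E i))%E.
  by apply: (anticoncentration z z_indep psi tau v) => //; exact: iota_uniq.
apply: le_trans (probability_bigI_ge z z_indep cut E cut_le E_in q p
  (ltW anticonc_prob_gt0) pE) _.
apply: le_measure; rewrite ?inE.
- exact: sigma_of_measurable (sigma_of_bigI z cut E cut_le E_in q).
- exact: sigma_of_measurable (adapted_ge z _ (adapted_linear_form z b _)).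
rewrite -bigcap_mkord => w Ew /=.
rewrite /linear_form sum_blocks.
have : tau / 16 * (((q * l)%:R / 2) / h) <=
   \sum_(i < q) tau / 16 * Num.sqrt (\sum_(k <- s i) b k ^+ 2).
  rewrite -mulr_sumr ler_pM2l ?divr_gt0// ler_pdivrMr// (le_trans eb)//.
  rewrite sum_blocks mulr_suml; apply: ler_sum => i _.
  rewrite -/(cut i) -/(cut i.+1) -/(s i).
  set e := \sum_(k <- _) _.
  have e0 : 0 <= e by apply: sumr_ge0 => ? _; exact: sqr_ge0.
  rewrite -[leLHS]sqr_sqrtr// expr2 ler_wpM2l ?sqrtr_ge0//.
  rewrite -[leRHS]gtr0_norm// -sqrtr_sqr ler_wsqrtr// (le_trans _ lh)//.
  rewrite /e; apply: (@le_trans _ _ (\sum_(k <- s i) 1)).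
    by apply: ler_sum => k _.
  rewrite big_const_seq count_predT size_iota /cut.
  by rewrite iter_addr_0 subnDl mulSn addnK.
have -> : tau / 16 * (((q * l)%:R / 2) / h) = tau / 32 * ((q * l)%:R / h).
  by field; rewrite gt_eqF.
move=> /le_trans; apply; apply: ler_sum => i _.
exact: (Ew (val i) (ltn_ord i)).
Qed.

(** Since cos ^ 2 + sin ^ 2 = 1, one of the two parts carries at least half of the
    energy of the window, whatever the frequency. *)
Lemma cos_sin_window a l q (h theta x : R) : 0 < h -> l%:R <= h ^+ 2 ->
  x = tau / 32 * ((q * l)%:R / h) ->
  ((p ^+ q)%:E <= P [set w |
     (x <= \sum_(a <= k < a + q * l) cos (k%:R * theta) * z k w)%R \/
     (x <= \sum_(a <= k < a + q * l) sin (k%:R * theta) * z k w)%R])%E.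
Proof.
move=> h0 lh xE.
pose c k := cos (k%:R * theta); pose s k := sin (k%:R * theta).
have me b := sigma_of_measurable P z
  (adapted_ge z x (adapted_linear_form z b (index_iota a (a + q * l)))).
have mU : measurable ([set w | (x <= linear_form z c (index_iota a (a + q * l)) w)%R] `|`
   [set w | (x <= linear_form z s (index_iota a (a + q * l)) w)%R]).
  by apply: measurableU; exact: me.
have cs1 k : c k ^+ 2 + s k ^+ 2 = 1 by exact: cos2Dsin2.
have energy : \sum_(a <= k < a + q * l) c k ^+ 2 +
    \sum_(a <= k < a + q * l) s k ^+ 2 = (q * l)%:R.
  rewrite -big_split/=; under eq_bigr do rewrite cs1.
  by rewrite big_const_nat iter_addr_0 addKn.
have [ec|ec] := leP ((q * l)%:R / 2) (\sum_(a <= k < a + q * l) c k ^+ 2).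
  rewrite [in leRHS]xE; apply: le_trans (linear_form_window c a l q h h0 lh _ ec) _.
    by move=> k; rewrite -(cs1 k) lerDl sqr_ge0.
  by rewrite -xE; apply: le_measure; rewrite ?inE// => w; left.
rewrite [in leRHS]xE; apply: le_trans (linear_form_window s a l q h h0 lh _ _) _.
- by move=> k; rewrite -(cs1 k) lerDr sqr_ge0.
- by move: ec; rewrite -energy; lra.
- by rewrite -xE; apply: le_measure; rewrite ?inE// => w; right.
Qed.

(** With q = 3 * Q ^ 2 blocks of length 4 ^ j the bound of [cos_sin_window] is
    tau / 32 * (3 * Q ^ 2 * 4 ^ j / 2 ^ j). *)
Definition hit Q (theta : R) j : set T := [set w |
  (tau * (3 / 32) * (Q ^ 2 * 2 ^ j)%:R <=
     \sum_(scale Q j <= k < scale Q j.+1) cos (k%:R * theta) * z k w)%R \/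
  (tau * (3 / 32) * (Q ^ 2 * 2 ^ j)%:R <=
     \sum_(scale Q j <= k < scale Q j.+1) sin (k%:R * theta) * z k w)%R].

Lemma hit_sigma Q theta j :
  sigma_of P z (interval (scale Q j) (scale Q j.+1)) (hit Q theta j).
Proof.
have sI : [set` index_iota (scale Q j) (scale Q j.+1)] =
    interval (scale Q j) (scale Q j.+1).
  by apply/seteqP; split => k /=; rewrite mem_index_iota.
rewrite -sI -[hit _ _ _]setCK setCU.
by apply: sigma_ofC; apply: sigma_ofI; apply: sigma_ofC; apply: adapted_ge;
  exact: adapted_linear_form.
Qed.

Lemma probability_hit Q theta j :
  ((p ^+ (3 * Q ^ 2))%:E <= P (hit Q theta j))%E.
Proof.
rewrite /hit scaleS.
have h0 : 0 < (2 ^ j)%:R :> R by rewrite ltr0n expn_gt0.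
apply: (cos_sin_window _ _ _ (2 ^ j)%:R) => //.
  by rewrite -natrX -expnM mulnC expnM.
have -> : (4 ^ j = 2 ^ j * 2 ^ j)%N by rewrite -expnMn.
by rewrite !natrM; field; rewrite gt_eqF.
Qed.

Lemma probability_no_hit Q theta j0 m :
  (P (\big[setI/setT]_(j < m) ~` hit Q theta (j0 + j)) <=
    ((1 - p ^+ (3 * Q ^ 2)) ^+ m)%:E)%E.
Proof.
have p1 : p <= 1 by rewrite ge_min lexx orbT.
apply: (probability_bigI_le z z_indep (fun j => scale Q (j0 + j))
  (fun j => ~` hit Q theta (j0 + j))).
- by move=> j; rewrite addnS scaleS leq_addr.
- by move=> j; rewrite addnS; apply: sigma_ofC; exact: hit_sigma.
- by rewrite subr_ge0 exprn_ile1// ltW// anticonc_prob_gt0.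
- move=> j; rewrite probability_setC; last exact: sigma_of_measurable (hit_sigma _ _ _).
  by rewrite EFinB; apply: leeB => //; exact: probability_hit.
Qed.

End Windows.

(** The three parameters are chosen in this order: Q makes the threshold in [hit],
    multiplied by beta, at least 3 * L times the square root of the end of the
    window (64 * 3 / 32 = 6, and the square root is 2 * Q * 2 ^ j); j0 puts the
    windows after N0; m is the number of windows. *)
Lemma stage_parameters {R : realType} (tau v beta L eps : R) (N0 : nat) :
  0 < tau -> 0 < v -> 0 < beta -> 0 < eps -> exists x : nat * nat * nat,
  let: (Q, j0, m) := x in
  [/\ (N0 < scale Q j0)%N, 64 * L <= beta * tau * Q%:R &
      (1 - anticonc_prob tau v ^+ (3 * Q ^ 2)) ^+ m <= eps].
Proof.
move=> tau0 v0 beta0 eps0.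
have p0 := anticonc_prob_gt0 tau v tau0 v0.
have bt0 : 0 < beta * tau by rewrite mulr_gt0.
pose Q := (Num.bound `|64 * L / (beta * tau)|).+1.
have LQ : 64 * L <= beta * tau * Q%:R.
  rewrite [leRHS]mulrC -ler_pdivrMr//; apply: ltW; apply: (le_lt_trans (ler_norm _)).
  have b := archi_boundP (normr_ge0 (64 * L / (beta * tau))).
  by apply: (lt_le_trans b); rewrite /Q ler_nat.
set q := 1 - anticonc_prob tau v ^+ (3 * Q ^ 2).
have p1 : anticonc_prob tau v <= 1 by rewrite ge_min lexx orbT.
have q0 : 0 <= q by rewrite subr_ge0 exprn_ile1// ltW.
have q1 : `|q| < 1 by rewrite ger0_norm// ltrBlDr ltrDl exprn_gt0.
have [m qm] : exists m, q ^+ m <= eps.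
  have /cvgrPdist_le/(_ _ eps0)[m _ /(_ m (leqnn m))] := cvg_expr q1.
  by rewrite sub0r normrN ger0_norm ?exprn_ge0// => qm; exists m.
exists (Q, N0, m); split => //.
rewrite /scale; apply: (@leq_trans (4 ^ N0)); last by rewrite leq_pmull// expn_gt0.
exact: ltn_expl.
Qed.

(** * Conditional expectations *)

Section ConditionalExpectation.
Context {R : realType} {d : measure_display} {T : measurableType d}
  {P : probability T R}.

Lemma integral_indicM {A : set T} {F : T -> R} {m} : measurable A ->
  mean_is P (fun w => \1_A w * F w) m -> (\int[P]_(w in A) (F w)%:E = m%:E)%E.
Proof.
move=> mA [_ <-]; rewrite integral_mkcond; apply: eq_integral => w _.
by rewrite patchE indicE; case: ifP; rewrite ?mul1r ?mul0r.
Qed.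

Lemma mean_indicM {A : set T} {F : T -> R} {m} : measurable A ->
  mean_is P F m -> exists m', mean_is P (fun w => \1_A w * F w) m'.
Proof.
move=> mA mF; have [m' mF'] := mean_abs P mF.
apply: (dominated_mean P _ mF').
  by apply: measurable_funM; [exact: measurable_indic|exact: mean_measurable mF].
by move=> w; rewrite indicE; case: (_ \in _); rewrite ?mul1r ?mul0r// normr0.
Qed.

Context {I : choiceType} (xi : I -> {RV P >-> R}).
Hypothesis xi_indep : mutually_independent xi.

Lemma adapted_indic {K} {A : set T} : sigma_of P xi K A -> adapted xi K \1_A.
Proof.
by move=> KA; apply/adaptedP; exact: (@measurable_indic _ (g_sigma_algebraType
  (\bigcup_(k in K) g_sigma_algebra_preimage (xi k)))).
Qed.

(** Conditioning keeps V, kills F, which is centred and independent of the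
    conditioning, and does not increase the mean of |W|.  The last point is
    obtained by testing Y - V against its own sign, which is measurable for
    the conditioning. *)
Lemma cond_exp_dist {K K' Z V F W Y mV e} : K `&` K' = set0 ->
  is_cond_exp P (sigma_of P xi K) Z Y -> (forall w, Z w = V w + F w + W w) ->
  adapted xi K V -> mean_is P V mV -> adapted xi K' F -> mean_is P F 0 ->
  measurable_fun setT W -> mean_is P (fun w => `|W w|) e ->
  exists2 e', mean_is P (fun w => `|Y w - V w|) e' & e' <= e.
Proof.
move=> KK' [iZ iY aY YZ] ZE aV mV_ aF mF mW mWe.
have [mz mZ] := integrable_mean P iZ; have [my mY] := integrable_mean P iY.
have aD := adaptedB xi aY aV.
have mD := meanD P mY (meanZ P (- 1) mV_).
have [e' De'] := mean_abs P mD.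
have {}De' : mean_is P (fun w => `|Y w - V w|) e'.
  by apply: mean_ext De' _ erefl => w; rewrite mulN1r.
exists e' => //.
have [mw mWw] := dominated_mean P mW mWe (fun w => lexx _).
have key A : sigma_of P xi K A -> exists d1 d2,
   [/\ mean_is P (fun w => \1_A w * (Y w - V w)) d1,
       mean_is P (fun w => \1_A w * W w) d2 & d1 = d2].
  move=> KA; have mA := sigma_of_measurable P xi KA.
  have [y1 my1] := mean_indicM mA mY.
  have [v1 mv1] := mean_indicM mA mV_.
  have [z1 mz1] := mean_indicM mA mZ.
  have mf1 := mean_mul_adapted xi xi_indep KK' (adapted_indic KA) aF (mean_indic P mA) mF.
  have mw1 := meanD P (meanD P mz1 (meanZ P (- 1) mv1)) (meanZ P (- 1) mf1).
  exists (y1 - v1), (z1 - v1); split.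
  - by apply: mean_ext (meanD P my1 (meanZ P (- 1) mv1)) _ _ => [w|]; ring.
  - by apply: mean_ext mw1 _ _ => [w|]; [rewrite ZE|]; ring.
  - have := YZ _ KA.
    by rewrite (integral_indicM mA my1) (integral_indicM mA mz1) => -[->].
have KA0 := adapted_ge xi 0 aD; set A := [set w | _] in KA0.
have KAT : sigma_of P xi K setT by exact: sigma_ofT.
have [d1 [d2 [md1 md2 d12]]] := key _ KA0.
have [c1 [c2 [mc1 mc2 c12]]] := key _ KAT.
have mD' := meanD P (meanZ P 2 md1) (meanZ P (- 1) mc1).
have mW' := meanD P (meanZ P 2 md2) (meanZ P (- 1) mc2).
have -> : e' = 2 * d1 + -1 * c1.
  apply: (mean_unique P De'); apply: mean_ext mD' _ erefl => w.
  rewrite indicT mul1r indicE; case: (boolP (w \in A)) => [|wA].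
    by rewrite inE /A/= => wA; rewrite ger0_norm//=; ring.
  move: wA; rewrite notin_setE/= => /negP; rewrite -ltNge => wA.
  by rewrite ltr0_norm//=; ring.
rewrite d12 c12; apply: (mean_le P mW' mWe) => w.
rewrite indicT mul1r indicE; case: (w \in A) => /=.
  by rewrite (_ : _ + _ = W w) ?ler_norm//; ring.
rewrite (_ : _ + _ = - W w); last by ring.
by rewrite -(normrN (W w)) ler_norm.
Qed.

End ConditionalExpectation.

(** * Sparse coefficient sequences *)

Section Spikes.
Context {R : realType} (N : nat -> nat).
Hypotheses (N0 : N 0 = 0%N) (N_lt : forall r, (N r < N r.+1)%N).

Definition spike_height r : R := 2^-1 ^+ r.+1 / (N r).+1%:R.

Definition spikes j : R := \sum_(r < j) (if N r.+1 == j then spike_height r else 0).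

Lemma spike_height_gt0 r : 0 < spike_height r.
Proof. by rewrite divr_gt0// exprn_gt0. Qed.

Lemma spikes_ge0 j : 0 <= spikes j.
Proof. by apply: sumr_ge0 => r _; case: ifP => // _; rewrite ltW// spike_height_gt0. Qed.

Lemma spike_pos_mono : {mono N : i j / (i <= j)%N}.
Proof. by apply: leq_mono; apply: homo_ltn => //; exact: ltn_trans. Qed.

Lemma spike_pos_ge r : (r <= N r)%N.
Proof. by elim: r => // r IH; exact: leq_ltn_trans IH (N_lt r). Qed.

Lemma spikes_at r : spikes (N r.+1) = spike_height r.
Proof.
have rN : (r < N r.+1)%N := spike_pos_ge r.+1.
rewrite /spikes (bigD1 (Ordinal rN))//= eqxx big1 ?addr0// => i ir.
case: eqP => // /eqP; rewrite eqn_leq !spike_pos_mono -eqn_leq eqSS => /eqP E.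
by move: ir; rewrite -val_eqE/= E eqxx.
Qed.

Lemma spikes_gap r j : (N r < j < N r.+1)%N -> spikes j = 0.
Proof.
move=> /andP[rj jr]; rewrite /spikes big1// => i _; case: eqP => // Ni.
exfalso; move: rj jr; rewrite -Ni !ltnNge !spike_pos_mono -!ltnNge !ltnS => h1 h2.
by have := leq_trans h2 h1; rewrite ltnn.
Qed.

(** A height at a position N s.+1 > N r is divided by N s + 1 >= N r + 1, and the
    remaining factors 2 ^ -(s + 1) add up to at most 2 ^ -r. *)
Lemma spikes_tail r M :
  \sum_((N r).+1 <= j < M) spikes j <= 2^-1 ^+ r / (N r).+1%:R.
Proof.
have step s : \sum_((N r).+1 <= j < (N (r + s)).+1) spikes j <=
    (2^-1 ^+ r - 2^-1 ^+ (r + s)) / (N r).+1%:R.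
  elim: s => [|s IH]; first by rewrite addn0 subrr mul0r big_geq.
  rewrite addnS (@big_cat_nat _ _ _ (N (r + s)).+1)//=; last 2 first.
  - by rewrite ltnS spike_pos_mono leq_addr.
  - by rewrite ltnS ltnW.
  rewrite [X in _ + X]big_nat_recr/=; last exact: N_lt.
  rewrite [X in _ + (X + _)]big_nat_cond [X in _ + (X + _)]big1 ?add0r; last first.
    by move=> j; rewrite andbT => h; apply: (spikes_gap (r + s)).
  rewrite spikes_at.
  apply: le_trans (lerD IH (_ : _ <= 2^-1 ^+ (r + s).+1 / (N r).+1%:R)) _.
    rewrite /spike_height ler_wpM2l ?exprn_ge0// lef_pV2 ?posrE// ler_nat ltnS.
    by rewrite spike_pos_mono leq_addr.
  by rewrite -mulrDl ler_wpM2r ?invr_ge0// exprS; lra.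
apply: le_trans (le_trans _ (step M)) _; last first.
  by rewrite ler_wpM2r ?invr_ge0// gerBl exprn_ge0.
have [MN|NM] := leqP M (N r).+1.
  by rewrite big_geq// sumr_ge0// => j _; exact: spikes_ge0.
have h : (M <= (N (r + M)).+1)%N.
  by rewrite ltnW// ltnS (leq_trans _ (spike_pos_ge _))// leq_addl.
rewrite [leRHS](@big_cat_nat _ _ _ M)//=; last exact: ltnW.
by rewrite lerDl sumr_ge0// => j _; exact: spikes_ge0.
Qed.

Lemma spikes_sum M : \sum_(0 <= j < M) spikes j <= 1.
Proof.
case: M => [|M]; first by rewrite big_geq.
rewrite big_ltn// {1}/spikes big_ord0 add0r.
by have := spikes_tail 0 M.+1; rewrite N0 expr0 divr1.
Qed.

Lemma square_summable_spikes : square_summable spikes.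
Proof.
apply: nondecreasing_is_cvgn.
  by apply: nondecreasing_series => j _ _; exact: sqr_ge0.
exists 1 => _ [M _ <-]; apply: le_trans (spikes_sum M).
rewrite /series/=; apply: ler_sum => j _.
rewrite expr2 ler_piMl ?spikes_ge0//; apply: le_trans (spikes_sum j.+1).
rewrite big_nat_recr//= lerDr sumr_ge0// => i _; exact: spikes_ge0.
Qed.

End Spikes.

(** * Moments of the noise *)

Section NoiseProfile.
Context {R : realType} {d : measure_display} {T : measurableType d}
  {P : probability T R} {I : choiceType} (xi : I -> {RV P >-> R}) (i0 : I).
Hypotheses (xi_id : identically_distributed xi)
  (xi_L2 : forall i, (xi i : T -> R) \in Lfun P 2%:E)
  (xi_centered : forall i, ('E_P[xi i] = 0)%E)
  (xi_nondegenerate : ('V_P[xi i0] <> 0)%E).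

Lemma mean_transfer {g : R -> R} {m i j} : measurable_fun setT g ->
  mean_is P (fun w => g (xi i w)) m -> mean_is P (fun w => g (xi j w)) m.
Proof.
move=> mg [/integrableP[mgi gi] gim].
have eqd f : (\int[distribution P (xi i)]_x f x = \int[distribution P (xi j)]_x f x)%E.
  by apply: eq_measure_integral => B mB _; exact: xi_id.
have mg' : measurable_fun setT (EFin \o g) by exact/measurable_EFinP.
have intj k : P.-integrable setT (fun w => (g (xi k w))%:E) <->
    (\int[distribution P (xi k)]_x `|(g x)%:E| < +oo)%E.
  have E : (\int[distribution P (xi k)]_x `|(g x)%:E| = \int[P]_w `|(g (xi k w))%:E|)%E.
    by rewrite ge0_integral_distribution//; exact: measurableT_comp.
  rewrite E; split => [/integrableP[]//|h]; apply/integrableP; split => //.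
  exact: (measurableT_comp mg').
have ij : P.-integrable setT (fun w => (g (xi j w))%:E).
  apply/intj; rewrite -eqd; apply/intj; exact/integrableP.
split => //; rewrite -gim.
have -> : (\int[P]_w (g (xi j w))%:E = \int[distribution P (xi j)]_x (EFin \o g) x)%E.
  by rewrite integral_distribution.
rewrite -eqd integral_distribution//; exact/integrableP.
Qed.

Lemma rv_mean i : mean_is P (xi i) 0.
Proof.
split; last by rewrite -expectation_def xi_centered.
apply/Lfun1_integrable; apply: Lfun_subset12; last exact: xi_L2.
exact: fin_num_measure.
Qed.

Lemma noise_variance : exists2 v, 0 < v & forall i, mean_is P (fun w => xi i w ^+ 2) v.
Proof.
have i2 : P.-integrable setT (EFin \o (fun w => xi i0 w ^+ 2)).
  by apply/Lfun1_integrable; exact: (Lfun2_mul_Lfun1 (xi_L2 i0) (xi_L2 i0)).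
have [v mv] := integrable_mean P i2.
exists v; last by move=> i; apply: (mean_transfer (g := fun x => x ^+ 2)) mv.
have v0 : 0 <= v by apply: (mean_le P (mean_cst P 0) mv) => w; exact: sqr_ge0.
rewrite lt_neqAle v0 andbT; apply/eqP => v_eq0; apply: xi_nondegenerate.
rewrite varianceE// xi_centered expe2 mule0 sube0.
by rewrite unlock; case: mv => _; rewrite -v_eq0.
Qed.

(** Take for psi the centred indicator of [0, +oo[.  As |x| = 2 * x * 1_(x >= 0) - x
    and the noise is centred, its correlation with psi is E|xi| / 2, which is
    positive because the variance is. *)
Lemma noise_correlation : exists (psi : R -> R) (tau : R),
  [/\ measurable_fun setT psi, forall x, `|psi x| <= 1, 0 < tau,
      forall i, mean_is P (psi \o xi i) 0 &
      forall i, mean_is P (fun w => xi i w * psi (xi i w)) tau].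
Proof.
pose pos : R -> R := \1_`[0, +oo[.
have mpos : measurable_fun setT pos by apply: measurable_indic; exact: measurable_itv.
have pos01 x : 0 <= pos x <= 1.
  by rewrite /pos indicE; case: (_ \in _); rewrite /= ?lexx ?ler01.
have posE x : pos x = (0 <= x)%R%:R.
  rewrite /pos indicE; congr (nat_of_bool _)%:R.
  by apply/idP/idP; rewrite inE/= in_itv/= andbT.
have mp i : measurable_fun setT (fun w => pos (xi i w)) by exact: measurableT_comp.
have [q mq] : exists q, mean_is P (fun w => pos (xi i0 w)) q.
  apply: (bounded_mean P 1) => // w.
  by have /andP[p0 p1] := pos01 (xi i0 w); rewrite ger0_norm.
have q01 : 0 <= q <= 1.
  apply/andP; split.
    by apply: (mean_le P (mean_cst P 0) mq) => w; case/andP: (pos01 (xi i0 w)).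
  by apply: (mean_le P mq (mean_cst P 1)) => w; case/andP: (pos01 (xi i0 w)).
have [u mu] := mean_abs P (rv_mean i0).
have mxpos : mean_is P (fun w => xi i0 w * (pos (xi i0 w) - q)) (u / 2).
  apply: mean_ext (meanD P (meanZ P (1 / 2) mu) (meanZ P (1 / 2 - q) (rv_mean i0))) _ _.
    move=> w; rewrite posE; case: (leP 0 (xi i0 w)) => x0 /=.
      by rewrite ger0_norm//; lra.
    by rewrite ltr0_norm//; lra.
  by lra.
exists (fun x => pos x - q), (u / 2); split.
- exact: measurable_funB.
- by move=> x; rewrite ler_norml; have := pos01 x; lra.
- have u0 : 0 <= u by apply: (mean_le P (mean_cst P 0) mu).
  rewrite divr_gt0// lt_neqAle u0 andbT; apply/eqP => u_eq0.
  have mx : measurable_fun setT (EFin \o xi i0) by apply/measurable_EFinP.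
  have /(ae_eq_integral_abs P measurableT mx) ae0 : (\int[P]_w `|(xi i0 w)%:E| = 0)%E.
    by case: mu => _; rewrite -u_eq0.
  have [v v0 mv] := noise_variance.
  have : (\int[P]_w ((xi i0 w) ^+ 2)%:E = 0)%E.
    rewrite (@ae_eq_integral _ _ _ _ _ (fun=> 0%E))//.
    + by rewrite integral0.
    + by apply/measurable_EFinP; apply: measurable_funX.
    + move: ae0; apply: filterS => w /(_ Logic.I) /= [->] _.
      by rewrite expr0n.
  by case: (mv i0) => _ -> [] /eqP; rewrite gt_eqF.
- move=> i; apply: (mean_transfer (g := fun x => pos x - q) (i := i0)).
    exact: measurable_funB.
  apply: mean_ext (meanD P mq (mean_cst P (- q))) _ _ => [w|]; by rewrite ?subrr.
- move=> i; apply: (mean_transfer (g := fun x => x * (pos x - q))) mxpos.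
  by apply: measurable_funM => //; exact: measurable_funB.
Qed.

Lemma noise_abs : exists u, forall i, mean_is P (fun w => `|xi i w|) u.
Proof.
have [u mu] := mean_abs P (rv_mean i0); exists u => i.
exact: (mean_transfer (g := fun x => `|x|)) mu.
Qed.

End NoiseProfile.

(** * Truncating the linear process in mean *)

Section LinearProcess.
Context {R : realType} {d : measure_display} {T : measurableType d}
  {P : probability T R}.

Lemma L1_le_L2 (f : T -> R) : measurable_fun setT f ->
  (\int[P]_w `|(f w)%:E| <= 'N[P]_2%:E[EFin \o f])%E.
Proof.
move=> mf.
have half : 2^-1 + 2^-1 = 1 :> R by lra.
have two0 : 0 < 2 :> R by [].
have := hoelder P mf (measurable_cst (1 : R)) two0 two0 half.
rewrite Lnorm1 -[X in (_ <= _ * X)%E]/('N[P]_2%:E[cst 1%E])%E Lnorm_cst1.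
rewrite [X in poweR X _](_ : _ = 1%E); last exact: probability_setT.
rewrite poweR1r mule1 (_ : (f \* cst 1)%R = f)//.
by apply/funext => w /=; rewrite mulr1.
Qed.

(** The heights are summable, so the triangle inequality in mean suffices.  It is
    applied to the truncation at M >= J; then M tends to infinity, and the
    remaining distance vanishes because convergence in L2 implies convergence
    in L1. *)
Lemma linear_process_tail (a : R^nat) (xi X : int -> {RV P >-> R}) (u t : R) J :
  (forall i, mean_is P (fun w => `|xi i w|) u) -> (forall j, 0 <= a j) ->
  (forall M, \sum_(J <= j < M) a j <= t) -> is_linear_process a xi X ->
  forall k, exists2 e,
    mean_is P (fun w => `|X k w - \sum_(0 <= j < J) a j * xi (k - j%:Z) w|) e &
    e <= t * u.
Proof.
move=> mu a0 at_ aX k.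
pose S M w := \sum_(0 <= j < M) a j * xi (k - j%:Z) w.
have mS M : measurable_fun setT (S M).
  by apply: measurable_sum => j; apply: measurable_funM.
have mXS M : measurable_fun setT (fun w => X k w - S M w) by exact: measurable_funB.
have u0 : 0 <= u by exact: (mean_le P (mean_cst P 0) (mu 0)).
have mB M : mean_is P (fun w => \sum_(J <= j < M) a j * `|xi (k - j%:Z) w|)
     ((\sum_(J <= j < M) a j) * u).
  elim: (index_iota J M) => [|j s IH].
    by apply: mean_ext (mean_cst P 0) _ _ => [w|]; rewrite big_nil// mul0r.
  apply: mean_ext (meanD P (meanZ P (a j) (mu (k - j%:Z))) IH) _ _ => [w|].
    by rewrite big_cons.
  by rewrite big_cons mulrDl.
have bound M : (J <= M)%N -> (\int[P]_w `|(X k w - S J w)%:E| <=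
    Lnorm P 2%:E (fun w => (X k w - S M w)%:E) + (t * u)%:E)%E.
  move=> JM; apply: (@le_trans _ _ (\int[P]_w (`|(X k w - S M w)%:E| +
      (\sum_(J <= j < M) a j * `|xi (k - j%:Z) w|)%:E))%E).
    apply: ge0_le_integral => //.
    - by apply: measurableT_comp => //; exact/measurable_EFinP.
    - apply: emeasurable_funD.
        by apply: measurableT_comp => //; exact/measurable_EFinP.
      exact/measurable_EFinP/(mean_measurable P (mB M)).
    - move=> w _; rewrite /= -EFinD lee_fin.
      have -> : X k w - S J w = (X k w - S M w) + \sum_(J <= j < M) a j * xi (k - j%:Z) w.
        by rewrite /S [in RHS](@big_cat_nat _ _ _ J)//=; ring.
      apply: (le_trans (ler_normD _ _)); rewrite lerD2l.
      apply: (le_trans (ler_norm_sum _ _ _)); apply: ler_sum => j _.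
      by rewrite normrM ger0_norm.
  rewrite ge0_integralD//; last 3 first.
  - by apply: measurableT_comp => //; exact/measurable_EFinP.
  - by move=> w _; rewrite lee_fin sumr_ge0// => j _; rewrite mulr_ge0.
  - exact/measurable_EFinP/(mean_measurable P (mB M)).
  apply: leeD; first exact: L1_le_L2.
  by case: (mB M) => _ ->; rewrite lee_fin ler_wpM2r.
have fin : (\int[P]_w `|(X k w - S J w)%:E| <= (t * u)%:E)%E.
  have cv : (fun M => Lnorm P 2%:E (fun w => (X k w - S M w)%:E) + (t * u)%:E)%E
      @ \oo --> (0 + (t * u)%:E)%E.
    by apply: cvgeD; [rewrite fin_num_adde_defl|exact: aX|exact: cvg_cst].
  rewrite -[leRHS]add0e; apply: (cvge_ge _ cv).
  by exists J => // M /= JM; exact: bound.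
have [e me] : exists e, mean_is P (fun w => `|X k w - S J w|) e.
  apply: integrable_mean; apply/integrableP; split.
    by apply/measurable_EFinP; exact: measurableT_comp.
  apply: le_lt_trans (ltry (t * u)); apply: le_trans fin.
  rewrite le_eqVlt; apply/orP; left; apply/eqP; apply: eq_integral => w _ /=.
  by rewrite normr_id.
exists e => //; rewrite -lee_fin; apply: le_trans fin.
by case: me => _ <-.
Qed.

End LinearProcess.

(** * Increments of the conditional Fourier transform *)

Section Increments.
Context {R : realType} {d : measure_display} {T : measurableType d}
  {P : probability T R}.

Lemma is_cond_expB {I : choiceType} (xi : I -> {RV P >-> R}) K Z1 Y1 Z2 Y2 :
  is_cond_exp P (sigma_of P xi K) Z1 Y1 -> is_cond_exp P (sigma_of P xi K) Z2 Y2 ->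
  is_cond_exp P (sigma_of P xi K) (fun w => Z1 w - Z2 w) (fun w => Y1 w - Y2 w).
Proof.
have iB F G : P.-integrable setT (EFin \o F) -> P.-integrable setT (EFin \o G) ->
    P.-integrable setT (EFin \o (fun w => F w - G w)).
  move=> iF iG; rewrite (_ : _ \o _ = (EFin \o F) \- (EFin \o G))%E//.
  exact: integrableB.
have intB A F G : measurable A -> P.-integrable setT (EFin \o F) ->
    P.-integrable setT (EFin \o G) ->
    (\int[P]_(w in A) (F w - G w)%:E =
     \int[P]_(w in A) (F w)%:E - \int[P]_(w in A) (G w)%:E)%E.
  move=> mA iF iG; rewrite integralB_EFin//; exact: integrableS measurableT _ _ _.
move=> [iZ1 iY1 aY1 YZ1] [iZ2 iY2 aY2 YZ2]; split.
- exact: iB.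
- exact: iB.
- exact: adaptedB.
- move=> A KA; have mA := sigma_of_measurable P xi KA.
  by rewrite !intB// YZ1// YZ2.
Qed.

Context (xi X : int -> {RV P >-> R}) (a : R^nat) (u t beta : R) (N0 N' : nat).
Hypotheses (xi_indep : mutually_independent xi)
  (xi_mean : forall i, mean_is P (xi i) 0)
  (xi_abs : forall i, mean_is P (fun w => `|xi i w|) u)
  (a_ge0 : forall j, 0 <= a j) (a_spike : a N' = beta)
  (a_gap : forall j, (N0 < j < N')%N -> a j = 0)
  (a_tail : forall M, \sum_(N'.+1 <= j < M) a j <= t)
  (X_linear : is_linear_process a xi X).

(** Here c stands for k -> cos(k theta) or k -> sin(k theta).  For k > N0 the
    spikes at positions j <= N0 multiply xi_(k - j) with k - j > 0, which is
    independent of the past; the spike at N' multiplies xi_(k - N'), which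
    belongs to the past as k <= N'; the spikes after N' are an error. *)
Lemma increment_dist (c : nat -> R) (Y : nat -> T -> R) n n' :
  (forall k, `|c k| <= 1) ->
  (forall n, is_cond_exp P (past xi) (fun w => \sum_(0 <= k < n) c k * X k%:Z w) (Y n)) ->
  (N0 < n)%N -> (n <= n')%N -> (n' <= N')%N ->
  exists2 e, mean_is P (fun w => `|Y n' w - Y n w -
      beta * \sum_(n <= k < n') c k * xi (k%:Z - N'%:Z) w|) e &
    e <= (n' - n)%:R * (t * u).
Proof.
move=> c1 Yc N0n nn' nN'.
have YB := is_cond_expB xi [set k : int | k <= 0] _ _ _ _ (Yc n') (Yc n).
(* The contributions of the spike at N', of the earlier and of the later ones. *)
pose V w := \sum_(n <= k < n') (c k * beta) * xi (k%:Z - N'%:Z) w.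
pose F w := \sum_(n <= k < n') c k * \sum_(0 <= j < N') a j * xi (k%:Z - j%:Z) w.
pose Rk k w := X k%:Z w - \sum_(0 <= j < N'.+1) a j * xi (k%:Z - j%:Z) w.
pose W w := \sum_(n <= k < n') c k * Rk k w.
have tail k := linear_process_tail a xi X u t N'.+1 xi_abs a_ge0 a_tail X_linear k%:Z.
pose e_ k := s2val (cid2 (tail k)).
have mR k : mean_is P (fun w => `|Rk k w|) (e_ k) := s2valP (cid2 (tail k)).
have e_le k : e_ k <= t * u := s2valP' (cid2 (tail k)).
have mRk k : measurable_fun setT (Rk k).
  by apply: measurable_funB => //; apply: measurable_sum => j; exact: measurable_funM.
have mW : measurable_fun setT W by apply: measurable_sum => k; exact: measurable_funM.
have mRs := mean_sum P (index_iota n n') _ _ mR.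
have Wle w : `|W w| <= \sum_(n <= k < n') `|Rk k w|.
  apply: (le_trans (ler_norm_sum _ _ _)); apply: ler_sum => k _.
  by rewrite normrM ler_piMl.
have [e0 me0] : exists e0, mean_is P (fun w => `|W w|) e0.
  apply: (dominated_mean P _ mRs); first exact: measurableT_comp.
  by move=> w; rewrite normr_id.
have e0le : e0 <= (n' - n)%:R * (t * u).
  apply: (le_trans (mean_le P me0 mRs Wle)).
  apply: (@le_trans _ _ (\sum_(n <= k < n') t * u)); first exact: ler_sum.
  by rewrite big_const_nat iter_addr_0 mulr_natl.
have ZE w : \sum_(0 <= k < n') c k * X k%:Z w - \sum_(0 <= k < n) c k * X k%:Z w =
    V w + F w + W w.
  rewrite (@big_cat_nat _ _ _ n)//= addrAC subrr add0r /V /F /W -!big_split/=.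
  apply: eq_bigr => k _; rewrite /Rk big_nat_recr//= a_spike; ring.
have aV : adapted xi [set k : int | k <= 0] V.
  apply: adapted_sum => k; rewrite mem_index_iota => /andP[_ kn'].
  apply: adaptedZ; apply: adapted_rv => /=.
  by rewrite subr_le0 lez_nat ltnW// (leq_trans kn').
have mV := mean_sum P (index_iota n n') (fun k w => (c k * beta) * xi (k%:Z - N'%:Z) w) _
  (fun k => meanZ P (c k * beta) (xi_mean (k%:Z - N'%:Z))).
have aF : adapted xi [set k : int | 0 < k] F.
  apply: adapted_sum => k; rewrite mem_index_iota => /andP[nk kn'].
  apply: adaptedZ; apply: adapted_sum => j; rewrite mem_index_iota => /andP[_ jN'].
  have [jN0|N0j] := leqP j N0; last first.
    apply: adapted_ext (adapted_cst xi _ 0) _ => w.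
    by rewrite a_gap ?mul0r// N0j.
  apply: adaptedZ; apply: adapted_rv => /=.
  by rewrite subr_gt0 ltz_nat (leq_ltn_trans jN0)// (leq_trans N0n).
have mF : mean_is P F 0.
  have := mean_sum P (index_iota n n') _ _ (fun k => meanZ P (c k)
    (mean_sum P (index_iota 0 N') _ _ (fun j => meanZ P (a j) (xi_mean (k%:Z - j%:Z))))).
  move=> h; apply: mean_ext h _ _ => //; rewrite big1// => k _.
  by rewrite big1 ?mulr0// => j _; rewrite mulr0.
have dis : [set k : int | k <= 0] `&` [set k : int | 0 < k] = set0.
  by apply/seteqP; split=> // k [/= h1 h2]; have := lt_le_trans h2 h1; rewrite ltxx.
have [e me ee0] := cond_exp_dist xi xi_indep dis YB ZE aV mV aF mF mW me0.
exists e; last exact: le_trans ee0 e0le.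
apply: mean_ext me _ erefl => w; congr `|_ - _|.
by rewrite mulr_sumr; apply: eq_bigr => k _; ring.
Qed.

End Increments.

(** * One stage of the construction *)

Section ComplexParts.
Context {R : realType}.

Lemma Re_le_normc (x : R[i]) : `|complex.Re x| <= Normc.normc x.
Proof.
by case: x => a b /=; rewrite -sqrtr_sqr ler_wsqrtr// lerDl sqr_ge0.
Qed.

Lemma Im_le_normc (x : R[i]) : `|complex.Im x| <= Normc.normc x.
Proof.
by case: x => a b /=; rewrite -sqrtr_sqr ler_wsqrtr// lerDr sqr_ge0.
Qed.

Lemma dft_parts {T : Type} (X : int -> T -> R) n theta w :
  complex.Re (dft X n theta w) = \sum_(0 <= k < n) cos (k%:R * theta) * X k%:Z w /\
  complex.Im (dft X n theta w) = \sum_(0 <= k < n) sin (k%:R * theta) * X k%:Z w.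
Proof.
rewrite /dft; elim: n => [|n [IHr IHi]]; first by rewrite !big_geq.
rewrite !big_nat_recr//= -IHr -IHi.
by case: (\sum_(0 <= k < n) _) => x y /=; rewrite !mulr0 subr0 add0r.
Qed.

End ComplexParts.

Section Large.
Context {R : realType} {d : measure_display} {T : measurableType d}.
Implicit Types (L : R) (Z : nat -> T -> R[i]).

Definition large L n0 Z : set T := [set w | exists2 n, (n0 <= n)%N &
  L * Num.sqrt n%:R <= Normc.normc (Z n w)].

Lemma large_sub {L L' n0 n0' Z} : L <= L' -> (n0 <= n0')%N ->
  large L' n0' Z `<=` large L n0 Z.
Proof.
move=> LL' nn' w [n n'n nZ]; exists n; first exact: leq_trans nn' n'n.
by apply: le_trans nZ; apply: ler_wpM2r => //; exact: sqrtr_ge0.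
Qed.

Lemma measurable_large {L n0 Z} :
  (forall n, measurable_fun setT (fun w => Normc.normc (Z n w))) ->
  measurable (large L n0 Z).
Proof.
move=> mZ; rewrite (_ : large L n0 Z = \bigcup_(n in [set n | (n0 <= n)%N])
    [set w | L * Num.sqrt n%:R <= Normc.normc (Z n w)]).
  by apply: bigcup_measurable => n _; exact: measurable_ge.
by apply/seteqP; split=> w [n ? ?]; exists n.
Qed.

End Large.

Section Stage.
Context {R : realType} {d : measure_display} {T : measurableType d}
  {P : probability T R}.
Context (xi X : int -> {RV P >-> R}) (psi : R -> R) (tau v u : R).
Hypotheses (xi_indep : mutually_independent xi)
  (mpsi : measurable_fun setT psi) (psi1 : forall x, `|psi x| <= 1)
  (xi_mean : forall i, mean_is P (xi i) 0)
  (xi_var : forall i, mean_is P (fun w => xi i w ^+ 2) v)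
  (psi_mean : forall i, mean_is P (psi \o xi i) 0)
  (corr : forall i, mean_is P (fun w => xi i w * psi (xi i w)) tau)
  (xi_abs : forall i, mean_is P (fun w => `|xi i w|) u)
  (tau0 : 0 < tau) (v0 : 0 < v).
Variables (a : R^nat) (t beta L : R) (N0 Q j0 m : nat).
Let N' := scale Q (j0 + m).
Hypotheses (a_ge0 : forall j, 0 <= a j) (a_spike : a N' = beta)
  (a_gap : forall j, (N0 < j < N')%N -> a j = 0)
  (a_tail : forall M, \sum_(N'.+1 <= j < M) a j <= t)
  (X_linear : is_linear_process a xi X)
  (beta0 : 0 < beta) (L1 : 1 <= L) (N0Q : (N0 < scale Q j0)%N)
  (LQ : 64 * L <= beta * tau * Q%:R).
Variables (theta : R) (E0S : nat -> T -> R[i]).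
Hypothesis E0S_cond : forall n : nat,
  is_complex_cond_exp P (past xi) (dft X n theta) (E0S n).

Lemma shifted_indep : mutually_independent (fun k : nat => xi (k%:Z - N'%:Z)).
Proof.
move=> s B us mB.
pose f (k : nat) := k%:Z - N'%:Z.
have fI : injective f by move=> x y /addIr [].
pose g (i : int) := absz (i + N'%:Z).
have fK k : g (f k) = k by rewrite /g /f subrK.
have us' : uniq (map f s) by rewrite map_inj_uniq.
have := xi_indep (map f s) (B \o g) us' (fun i => mB (g i)).
rewrite big_map; under eq_bigr do rewrite /= fK.
move=> <-; congr (P _); apply/seteqP; split=> w H.
  by move=> _ /= /mapP[k ks ->] /=; rewrite fK; exact: H.
by move=> k /= ks; have := H (f k); rewrite /= fK; apply; exact: map_f.
Qed.

Lemma measurable_normc_cond n : measurable_fun setT (fun w => Normc.normc (E0S n w)).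
Proof.
have [[_ /measurable_int /measurable_EFinP mRe _ _]
      [_ /measurable_int /measurable_EFinP mIm _ _]] := E0S_cond n.
rewrite (_ : (fun w => _) = (fun w =>
    Num.sqrt (complex.Re (E0S n w) ^+ 2 + complex.Im (E0S n w) ^+ 2))).
  apply: (measurableT_comp (continuous_measurable_fun (@sqrt_continuous R))).
  by apply: measurable_funD; exact: measurable_funX.
by apply/funext => w; case: (E0S n w).
Qed.

(** The real and the imaginary part are treated together: [part] is one of these
    and [trig] is cos or sin accordingly. *)
Definition part_dist (part : R[i] -> R) (trig : R -> R) j w :=
  part (E0S (scale Q (j0 + j.+1)) w) - part (E0S (scale Q (j0 + j)) w) -
  beta * \sum_(scale Q (j0 + j) <= k < scale Q (j0 + j.+1))
     trig (k%:R * theta) * xi (k%:Z - N'%:Z) w.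

Definition part_error part trig j : set T := [set w | 1 <= `|part_dist part trig j w|].

Definition window_length j := (scale Q (j0 + j.+1) - scale Q (j0 + j))%N.

Lemma probability_part_error part trig j :
  (part = @complex.Re R /\ trig = cos) \/ (part = @complex.Im R /\ trig = sin) ->
  (j < m)%N ->
  measurable (part_error part trig j) /\
  (P (part_error part trig j) <= ((window_length j)%:R * (t * u))%:E)%E.
Proof.
move=> pt jm.
have trig1 x : `|trig x| <= 1.
  rewrite ler_norml; case: pt => [[_ ->]|[_ ->]].
    by rewrite cos_geN1 cos_le1.
  by rewrite sin_geN1 sin_le1.
have cY n : is_cond_exp P (past xi)
    (fun w => \sum_(0 <= k < n) trig (k%:R * theta) * X k%:Z w)
    (fun w => part (E0S n w)).
  have [cRe cIm] := E0S_cond n.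
  case: pt => [[-> ->]|[-> ->]].
    by under eq_fun do rewrite -(dft_parts X n theta _).1.
  by under eq_fun do rewrite -(dft_parts X n theta _).2.
have [e me ee] := increment_dist xi X a u t beta N0 N' xi_indep xi_mean xi_abs a_ge0
  a_spike a_gap a_tail X_linear (fun k => trig (k%:R * theta)) (fun n w => part (E0S n w))
  (scale Q (j0 + j)) (scale Q (j0 + j.+1)) (fun k => trig1 _) cY
  (leq_trans N0Q (scale_mono (leq_addr _ _)))
  (scale_mono (leq_add (leqnn _) (leqnSn _)))
  (scale_mono (leq_add (leqnn _) jm)).
split; first by apply: measurable_ge; exact: (mean_measurable P me).
apply: (le_trans (markov_mean P 1 ltr01 me)).
by rewrite lee_fin divr1.
Qed.

(** With s = Q * 2 ^ (j0 + j), the square roots of the two ends of the window are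
    s and 2 * s.  A hit makes beta times the window sum at least 6 * L * s; the
    error costs less than 1 <= L * s; so one of the two values whose difference
    is taken has modulus at least 2 * L * s. *)
Lemma large_from_part part trig j w :
  (forall x, `|part x| <= Normc.normc x) -> ~ part_error part trig j w ->
  tau * (3 / 32) * (Q ^ 2 * 2 ^ (j0 + j))%:R <=
    \sum_(scale Q (j0 + j) <= k < scale Q (j0 + j.+1))
      trig (k%:R * theta) * xi (k%:Z - N'%:Z) w ->
  large L (scale Q j0) E0S w.
Proof.
move=> partN /negP; rewrite -ltNge /part_dist.
set D := part _; set D' := part _; set S := \sum_(_ <= _ < _) _ => err xS.
have Q0 : (0 < Q)%N.
  by case: (Q) N0Q => // ; rewrite /scale exp0n// mul0n.
set s : R := (Q * 2 ^ (j0 + j))%:R.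
have s1 : 1 <= s by rewrite ler1n muln_gt0 Q0 expn_gt0.
have bS : 6 * L * s <= beta * S.
  apply: (@le_trans _ _ (beta * (tau * (3 / 32) * (Q ^ 2 * 2 ^ (j0 + j))%:R))); last first.
    by rewrite ler_pM2l.
  have -> : beta * (tau * (3 / 32) * (Q ^ 2 * 2 ^ (j0 + j))%:R) =
     (beta * tau * Q%:R) * (3 / 32) * s by rewrite /s -mulnn !natrM; ring.
  rewrite ler_wpM2r ?(le_trans ler01 s1)//.
  by move: LQ; set q := beta * tau * Q%:R; lra.
have Ls : 1 <= L * s by rewrite mulr_ege1.
have DD : 4 * L * s <= `|D| + `|D'|.
  apply: (@le_trans _ _ (D - D')); last first.
    by apply: (le_trans (ler_norm _)); exact: ler_normB.
  by move: err; rewrite ltr_norml => /andP[+ _]; lra.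
have sS : Num.sqrt (scale Q (j0 + j.+1))%:R = 2 * s :> R.
  by rewrite sqrt_scale /s addnS expnS mulnCA natrM.
have [D4|D4] := leP (2 * L * s) `|D|.
  exists (scale Q (j0 + j.+1)); first by apply: scale_mono; exact: leq_addr.
  by rewrite sS; apply: le_trans (partN _); rewrite -/D; lra.
exists (scale Q (j0 + j)); first by apply: scale_mono; exact: leq_addr.
by rewrite sqrt_scale -/s; apply: le_trans (partN _); rewrite -/D'; lra.
Qed.

Lemma sum_window_length : (\sum_(j < m) window_length j <= N')%N.
Proof.
suff -> : (\sum_(j < m) window_length j = scale Q (j0 + m) - scale Q (j0 + 0))%N.
  exact: leq_subr.
elim: (m) => [|k IH]; first by rewrite big_ord0 subnn.
rewrite big_ord_recr/= IH /window_length addnC addnBA ?subnK//; apply: scale_mono.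
  by rewrite leq_add2l.
by rewrite addn0 leq_addr.
Qed.

(** Outside the event [large] either every window misses, or the approximation
    fails in some window.  The probability of failure is proportional to the length of the window, and the
    lengths add up to at most N'; hence the bound 2 * N' * t * u for the real and
    imaginary parts together, whatever the number of windows. *)
Lemma probability_not_large :
  (P (~` large L (scale Q j0) E0S) <= ((1 - anticonc_prob tau v ^+ (3 * Q ^ 2)) ^+ m
     + 2 * N'%:R * (t * u))%:E)%E.
Proof.
pose z (k : nat) := xi (k%:Z - N'%:Z).
pose NH := \big[setI/setT]_(j < m) ~` hit z tau Q theta (j0 + j).
pose err j := part_error (@complex.Re R) cos j `|` part_error (@complex.Im R) sin j.
have reP j (jm : (j < m)%N) :=
  probability_part_error _ _ j (or_introl (conj erefl erefl)) jm.
have imP j (jm : (j < m)%N) :=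
  probability_part_error _ _ j (or_intror (conj erefl erefl)) jm.
have merr j : (j < m)%N -> measurable (err j).
  by move=> jm; apply: measurableU; [case: (reP j jm)|case: (imP j jm)].
have mNH : measurable NH.
  apply: bigsetI_measurable => j _; apply: measurableC.
  exact: sigma_of_measurable (hit_sigma z tau Q theta _).
have merrs : measurable (\big[setU/set0]_(j < m) err j).
  by apply: bigsetU_measurable => j _; exact: merr.
have sub : ~` large L (scale Q j0) E0S `<=` NH `|` \big[setU/set0]_(j < m) err j.
  move=> w wl; apply: contrapT => /not_orP[wNH werr]; apply: wl.
  move: wNH; rewrite /NH -(bigcap_mkord _ (fun j => ~` hit z tau Q theta (j0 + j))).
  move=> /existsNP[j /not_implyP[jm /contrapT hj]].
  have [nre nim] : ~ part_error (@complex.Re R) cos j w /\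
                   ~ part_error (@complex.Im R) sin j w.
    by apply/not_orP => e; apply: werr; rewrite -bigcup_mkord; exists j.
  move: hj; rewrite /hit /= -addnS => -[h|h].
    exact: (large_from_part _ _ j w (@Re_le_normc R) nre h).
  exact: (large_from_part _ _ j w (@Im_le_normc R) nim h).
apply: (@le_trans _ _ (P (NH `|` \big[setU/set0]_(j < m) err j))).
  apply: le_measure => //; rewrite inE; last exact: measurableU.
  by apply: measurableC; exact: measurable_large measurable_normc_cond.
apply: (le_trans (measureU2 P mNH merrs)); rewrite EFinD; apply: leeD.
  exact: (probability_no_hit z shifted_indep psi tau v mpsi psi1 (fun=> xi_mean _)
    (fun=> xi_var _) (fun=> psi_mean _) (fun=> corr _) tau0 v0).
apply: (le_trans (Boole_inequality P merr)).
have u0 : 0 <= u by exact: (mean_le P (mean_cst P 0) (xi_abs 0)).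
have t0 : 0 <= t by have := a_tail 0; rewrite big_geq.
apply: (@le_trans _ _ (\sum_(j < m) (2 * ((window_length j)%:R * (t * u)))%:E)%E).
  apply: lee_sum => j _.
  have [mre re] := reP j (ltn_ord j); have [mim im] := imP j (ltn_ord j).
  apply: (le_trans (measureU2 P mre mim)).
  by rewrite mulrDl mul1r EFinD; exact: leeD.
rewrite sumEFin lee_fin -mulr_sumr -mulr_suml -mulrA ler_wpM2l// ler_wpM2r ?mulr_ge0//.
by rewrite -natr_sum ler_nat sum_window_length.
Qed.

End Stage.

(** * The theorem *)

Lemma limn_esup_pinfty {R : realType} (u : (\bar R)^nat) :
  (forall M : nat, exists2 n, (M <= n)%N & (M%:R%:E <= u n)%E) ->
  limn_esup u = +oo%E.
Proof.
move=> uM; rewrite limn_esup_lim (_ : esups u = fun=> +oo%E); first exact: lim_cst.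
apply/funext => k; apply: eq_infty => A.
have [n kn un] := uM (maxn k (Num.bound `|A|)).
apply: (@le_trans _ _ (u n)); last first.
  apply: ereal_sup_ubound; exists n => //=.
  exact: leq_trans (leq_maxl _ _) kn.
apply: le_trans un; rewrite lee_fin (le_trans (ler_norm A))//.
apply: (le_trans (ltW (archi_boundP (normr_ge0 A)))).
by rewrite ler_nat leq_maxr.
Qed.

Fixpoint iter_stage (next : nat -> nat -> nat) r :=
  if r is r'.+1 then next r' (iter_stage next r') else 0%N.

Lemma le0_of_geometric {R : realType} (x : \bar R) (c : R) (M : nat) :
  (forall r, (M <= r)%N -> (x <= (c * 2^-1 ^+ r)%:E)%E) -> (x <= 0)%E.
Proof.
move=> xc.
have half : `|2^-1 : R| < 1 by rewrite ger0_norm//; lra.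
have cv : (fun r => (c * 2^-1 ^+ r)%:E) @ \oo --> (c * 0)%:E.
  by apply: cvg_EFin; [exact: nearW|apply: cvgMr; exact: cvg_expr].
rewrite -[0%E]/(0%:E) -(mulr0 c); apply: (cvge_ge _ cv).
by exists M => // r /= Mr; exact: xc.
Qed.

Theorem proposition3 (R : realType) (d : measure_display)
    (T : measurableType d) (P : probability T R)
    (xi : int -> {RV P >-> R})
    (xi_iid : iid xi)
    (xi_L2 : forall k : int, (xi k : T -> R) \in Lfun P 2%:E)
    (xi_centered : forall k : int, ('E_P[xi k] = 0)%E)
    (xi_nondegenerate : ('V_P[xi 0%R] <> 0)%E) :
  exists a : R^nat, square_summable a /\
    forall X : int -> {RV P >-> R}, is_linear_process a xi X ->
    forall theta : R, 0 <= theta < 2 * pi ->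
    forall E0S : nat -> T -> R[i],
      (forall n : nat,
        is_complex_cond_exp P (past xi) (dft X n theta) (E0S n)) ->
      P [set w | limn_esup
                   (fun n : nat => (Normc.normc (E0S n w) / Num.sqrt n%:R)%:E)
                 = +oo%E] = 1%E.
Proof.
have [xi_indep xi_id] := xi_iid.
have xi_mean := rv_mean xi xi_L2 xi_centered.
have [psi [tau [mpsi psi1 tau0 psi_mean corr]]] :=
  noise_correlation xi 0 xi_id xi_L2 xi_centered xi_nondegenerate.
have [v v0 xi_var] := noise_variance xi 0 xi_id xi_L2 xi_centered xi_nondegenerate.
have [u xi_abs] := noise_abs xi 0 xi_id xi_L2 xi_centered.
have half0 r : 0 < 2^-1 ^+ r :> R by rewrite exprn_gt0// invr_gt0.
have /choice[f fP] (rN : nat * nat) := stage_parameters tau v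
  (2^-1 ^+ rN.1.+1 / (rN.2).+1%:R) rN.1.+1%:R (2^-1 ^+ rN.1) rN.2 tau0 v0
  (divr_gt0 (half0 _) (ltr0Sn _ _)) (half0 _).
pose next r N := let: (Q, j0, m) := f (r, N) in scale Q (j0 + m).
pose N := iter_stage next.
have N_lt r : (N r < N r.+1)%N.
  have -> : N r.+1 = next r (N r) by [].
  rewrite /next; have := fP (r, N r).
  case: (f _) => [[Q j0] m] [h _ _]; apply: leq_trans h _.
  by apply: scale_mono; exact: leq_addr.
exists (spikes N); split; first exact: square_summable_spikes.
move=> X X_linear theta _ E0S E0S_cond.
pose U (M : nat) := large M%:R M E0S.
have mE n := measurable_normc_cond xi X theta E0S E0S_cond n.
have mU M : measurable (U M) := measurable_large mE.
have u0 : 0 <= u by exact: (mean_le P (mean_cst P 0) (xi_abs 0)).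
(* The heights divide by N r.+1 + 1, which absorbs the union bound over the
   windows. *)
have stage r : (P (~` U r) <= ((1 + u) * 2^-1 ^+ r)%:E)%E.
  have Nr : N r.+1 = next r (N r) by [].
  move: Nr; rewrite /next; have := fP (r, N r).
  case: (f _) => [[Q j0] m] /= [NQ LQ epsm] Nr.
  have spike : spikes N (scale Q (j0 + m)) = spike_height N r :> R.
    by rewrite -Nr; exact: spikes_at.
  have gap j : (N r < j < scale Q (j0 + m))%N -> spikes N j = 0 :> R.
    by rewrite -Nr; exact: spikes_gap.
  have tail M : \sum_((scale Q (j0 + m)).+1 <= j < M) spikes N j <=
      2^-1 ^+ r.+1 / (N r.+1).+1%:R :> R.
    by rewrite -Nr; exact: spikes_tail.
  have L1 : 1 <= r.+1%:R :> R by rewrite ler1n.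
  have est := probability_not_large xi X psi tau v u xi_indep mpsi psi1 xi_mean
    xi_var psi_mean corr xi_abs tau0 v0 (spikes N) _ _ r.+1%:R (N r) Q j0 m
    (spikes_ge0 N) spike gap tail X_linear (spike_height_gt0 N r) L1 NQ LQ theta
    E0S E0S_cond.
  have rN : (r <= scale Q j0)%N.
    by rewrite (leq_trans _ (ltnW NQ))// spike_pos_ge.
  apply: (@le_trans _ _ (P (~` large r.+1%:R (scale Q j0) E0S))).
    apply: le_measure; rewrite ?inE.
    - exact: measurableC.
    - by apply: measurableC; exact: measurable_large mE.
    by apply: subsetC; apply: large_sub => //; rewrite ler_nat.
  apply: (le_trans est); rewrite lee_fin [leRHS]mulrDl mul1r; apply: lerD => //.
  rewrite -Nr exprS.
  set x : R := (N r.+1)%:R.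
  have -> : 2 * x * (2^-1 * 2^-1 ^+ r / (N r.+1).+1%:R * u) =
     (x / (x + 1)) * (u * 2^-1 ^+ r).
    by rewrite -natr1 -/x; field; rewrite natr1 /x pnatr_eq0.
  rewrite ler_piMl ?mulr_ge0 ?(ltW (half0 _))//.
  by rewrite ler_pdivrMr ?mul1r /x ?natr1 ?ltr0n// ler_nat.
(* [U r] decreases in r, so the bound at every stage r >= M applies to U M. *)
have PU M : P (~` U M) = 0%E.
  apply/eqP; rewrite eq_le measure_ge0 andbT.
  apply: (le0_of_geometric _ (1 + u) M) => r Mr; apply: le_trans (stage r).
  apply: le_measure; rewrite ?inE; [exact: measurableC|exact: measurableC|].
  by apply: subsetC; apply: large_sub => //; rewrite ler_nat.
set S := [set w | _].
have mS : measurable S.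
  have ml : measurable_fun setT (fun w => limn_esup
      (fun n => (Normc.normc (E0S n w) / Num.sqrt n%:R)%:E)).
    apply: measurable_fun_limn_esup => n; apply/measurable_EFinP.
    by apply: measurable_funM => //; exact: mE.
  have := ml measurableT _ (emeasurable_set1 +oo%E).
  by rewrite setTI.
have negl : P.-negligible (~` S).
  have : P.-negligible (\bigcup_M ~` U M).
    apply: negligible_bigcup => M; exists (~` U M); split => //.
      exact: measurableC.
    exact: PU.
  apply: negligibleS.
  move=> w Sw; apply: contrapT => Uw; apply: Sw; apply: limn_esup_pinfty => M.
  have [n Mn nE] : U M w by apply: contrapT => h; apply: Uw; exists M.
  exists n => //; rewrite lee_fin; have [n0|n0] := posnP n.
    by move: Mn; rewrite n0 leqn0 => /eqP ->; rewrite sqrtr0 invr0 mulr0.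
  by rewrite ler_pdivlMr// sqrtr_gt0 ltr0n.
have := probability_setC P (measurableC mS).
by rewrite setCK => ->; rewrite (measure_negligible (measurableC mS) negl) sube0.
Qed.
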